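(* When $m$ is even, $$Z_m(x_1,\dots,x_m)=\prod_{1\le i<j\le m}\frac{1-x_ix_j}{x_i-x_j}\cdot\mathrm{Pf}\left(\frac{x_i-x_j}{1-x_ix_j}Q(x_i,x_j)\right)_{1\le i,j\le m},$$ where $Q(x_i,x_j)=(1-h(x_i))(1-h(x_j))-\frac{h(x_i)h(x_j)}{ac}\cdot\frac{(1-q)x_ix_j}{1-qx_ix_j}$.
   Context: Fix complex $q,a,c$. Edge states in $\{0,1\}$. Bulk weights $R_z(i,j;k,l)$: $1$ for $(0,0,0,0)$, $(1,1,1,1)$; $\frac{q(1-z)}{1-qz}$ for $(1,0,1,0)$; $\frac{1-q}{1-qz}$ for $(1,0,0,1)$; $\frac{1-z}{1-qz}$ for $(0,1,0,1)$; $\frac{z(1-q)}{1-qz}$ for $(0,1,1,0)$; $0$ otherwise ($i$ incoming bottom, $j$ incoming left, $k$ outgoing top, $l$ outgoing right at a crossing of a left-to-right and bottom-to-top line). $h(x)=\frac{ac(1-x^2)}{(a-x)(c-x)}$, $K_x(0;0)=1-h(x)$, $K_x(0;1)=h(x)$, $K_x(1;0)=-h(x)/(ac)$, $K_x(1;1)=1+h(x)/(ac)$ (incoming; outgoing). $Z_m(x_1,\dots,x_m)$ is the partition function of the lattice with $m$ upward lines: line $i$ (parameter $x_i$) enters from the bottom in state $0$, crosses horizontal rows $1,\dots,i-1$, meets a boundary vertex of weight $K_{x_i}(s;s')$ ($s$ arriving from below, $s'$ leaving to the right), then continues as horizontal row $i$ moving right across vertical lines $i+1,\dots,m$ and exits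 on the right in state $0$. The crossing of vertical line $i$ with row $j$ ($j<i$) has weight $R_{x_ix_j}(b,\ell;t,r)$ ($b,t$ bottom/top, $\ell,r$ left/right states). $\mathrm{Pf}$ denotes the Pfaffian of an even-size skew-symmetric matrix. *)

(* Defs.v *)
(* MathComp; complex numbers are R[i] for R : realType. *)
From HB Require Import structures.
From mathcomp Require Export all_boot all_order all_algebra all_fingroup.
From mathcomp Require Export reals complex.

Set Implicit Arguments.
Unset Strict Implicit.
Unset Printing Implicit Defensive.

Import Order.TTheory GRing.Theory Num.Theory.
Local Open Scope ring_scope.

(* Edge states 0 and 1 are the booleans false and true. *)

(* R_z(b, l; t, r): incoming bottom and left, outgoing top and right. *)
Definition bulk_weight (F : fieldType) (q z : F) (b l t r : bool) : F :=
  match b, l, t, r with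
  | false, false, false, false => 1
  | true, true, true, true => 1
  | true, false, true, false => q * (1 - z) / (1 - q * z)
  | true, false, false, true => (1 - q) / (1 - q * z)
  | false, true, false, true => (1 - z) / (1 - q * z)
  | false, true, true, false => z * (1 - q) / (1 - q * z)
  | _, _, _, _ => 0
  end.

Definition hfun (F : fieldType) (a c x : F) : F :=
  a * c * (1 - x ^+ 2) / ((a - x) * (c - x)).

(* K_x(s; s'): incoming, outgoing. *)
Definition boundary_weight (F : fieldType) (a c x : F) (s s' : bool) : F :=
  match s, s' with
  | false, false => 1 - hfun a c x
  | false, true => hfun a c x
  | true, false => - hfun a c x / (a * c)
  | true, true => 1 + hfun a c x / (a * c)
  end.

(* Lines are indexed from 0.  In the order of travel, line i meets m vertices,
   numbered k = 0, ..., m.-1: for k < i its crossing, as a vertical line, with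
   row k; for k = i its boundary vertex; for k > i its crossing, as a row, with
   vertical line k.  Hence line i carries m.+1 edges: e (i, k) is the state of
   the edge entering its k-th vertex, e (i, k.+1) that of the edge leaving it,
   e (i, 0) is its entrance at the bottom, and e (i, m) its exit on the
   right. *)
Definition edge_config (m : nat) := {ffun 'I_m * 'I_m.+1 -> bool}.

Definition edge_in (m : nat) (e : edge_config m) (i k : 'I_m) : bool :=
  e (i, widen_ord (leqnSn m) k).

Definition edge_out (m : nat) (e : edge_config m) (i k : 'I_m) : bool :=
  e (i, lift ord0 k).

Definition empty_ends (m : nat) (e : edge_config m) : bool :=
  [forall i : 'I_m, ~~ e (i, ord0) && ~~ e (i, ord_max)].

Definition config_weight (F : fieldType) (q a c : F) (m : nat) (x : 'I_m -> F)
    (e : edge_config m) : F :=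
  (\prod_(i < m) boundary_weight a c (x i) (edge_in e i i) (edge_out e i i)) *
  \prod_(i < m) \prod_(j < m | (j < i)%N)
    bulk_weight q (x i * x j)
      (edge_in e i j) (edge_in e j i) (edge_out e i j) (edge_out e j i).

Definition partition_function (F : fieldType) (q a c : F) (m : nat)
    (x : 'I_m -> F) : F :=
  \sum_(e : edge_config m | empty_ends e) config_weight q a c x e.

Definition Qfun (F : fieldType) (q a c x y : F) : F :=
  (1 - hfun a c x) * (1 - hfun a c y) -
  hfun a c x * hfun a c y / (a * c) * ((1 - q) * x * y / (1 - q * x * y)).

(* Pf A = 1 / (2^n n!) * sum_s sgn(s) prod_(k < n) A (s 2k) (s (2k+1)) for A of
   size m = 2n, in characteristic 0; for even m and even i < m, ordS i is
   i + 1, without wrapping around.  Only meaningful for even m and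
   skew-symmetric A. *)
Definition pfaffian (F : fieldType) (m : nat) (A : 'M[F]_m) : F :=
  ((2 ^ m./2 * (m./2)`!)%N%:R)^-1 *
  \sum_(s : 'S_m) (-1) ^+ s * \prod_(i < m | ~~ odd i) A (s i) (s (ordS i)).

(* Main.v *)
(** Both sides are rational functions of the first parameter [X] with explicit
    denominators, and they are compared by Lagrange interpolation in [X],
    by induction on the number of lines.  The Yang-Baxter and reflection
    equations make the lattice partition function symmetric; this reduces its
    value at [X = 1 / x_j] to the case of the first two lines, where the
    crossing degenerates into two turns and [K_x K_(1/x) = 1], so that both
    lines disappear.  At [X = 1] and [X = -1] the matrix [K_X] is the identity
    and one line disappears, and at [X = 0] the value is [0].  One line fewer
    means odd size, for which the formula is a Pfaffian bordered by a row
    [1 - h(x_j)].  Pfaffians with equal rows vanish, and the expansion along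
    the first row yields the same values and the degree bound.

    Interpolation requires parameters in general position.  These are reached by
    moving [q], [a], [c] and all [x_i] along polynomial curves in one variable [t];
    at [t = 0] both sides are regular, so the identity extends to [t = 0]. *)
Require Import Defs.
From mathcomp Require Import ring.
Set Implicit Arguments.
Unset Strict Implicit.
Unset Printing Implicit Defensive.
Import Order.TTheory GRing.Theory Num.Theory.
Local Open Scope ring_scope.

(** * The lattice as iterated row transfer *)


(** With n further lines, multiplication by [(a - X) * (c - X)] and by all [1 - q * X * y] and
    [X - y] makes both sides polynomials in X of degree at most 2n + 2, and the 2n + 3 nodes 0, 1,
    -1, y, 1/y are just enough. The nodes y need no lattice computation: the factor [X - y] kills
    the lattice side, and a repeated row y kills the Pfaffian side. At X = 1/y the only term to
    survive the factor [1 - X * y] has coefficient Q(1/y, y), the (0;0) entry of K_(1/y) K_y = 1.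
    The nodes 1 and -1 link the two parities: for x^2 = 1 one has (x - y) / (1 - x y) = x and Q(x,
    y) = 1 - h(y), so the border is the row of the point 1. Division by 0 returns 0 here, so a
    formula means nothing at its poles. Identities are therefore claimed outside the zeros of a
    polynomial, and a value is used only at a point where the function still equals a quotient of
    polynomials; at a node that is a removable pole, a pole-free expression replaces the formula. *)

Lemma sum_bool (F : nmodType) (f : bool -> F) : \sum_(b : bool) f b = f false + f true.
Proof. by rewrite big_bool addrC. Qed.

Section Lattice.
Variables (F : fieldType) (q a c : F).

(* Row with parameter [x], left state [l] and bottom states [v], weighted by the
   continuation [k] of its top states; it must exit on the right in state 0. *)
Fixpoint row_weight (x : F) (l : bool) (s : seq F) (v : seq bool)
    (k : seq bool -> F) : F :=
  match s, v with
  | [::], [::] => if l then 0 else k [::]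
  | y :: s', b :: v' =>
      \sum_(r : bool) \sum_(t : bool)
        bulk_weight q (x * y) b l t r * row_weight x r s' v' (fun w => k (t :: w))
  | _, _ => 0
  end.

(** The first line meets its boundary vertex at once and then is the lowest row. Removing it leaves
    a lattice of the same kind, whose entrances are the top edges of that row. Lists of different
    lengths get the junk value 0. *)
Fixpoint lattice (s : seq F) (v : seq bool) : F :=
  match s, v with
  | [::], [::] => 1
  | x :: s', b :: v' =>
      \sum_(l : bool) boundary_weight a c x b l * row_weight x l s' v' (lattice s')
  | _, _ => 0
  end.

Lemma eq_row_weight x l s v k k' : k =1 k' -> row_weight x l s v k = row_weight x l s v k'.
Proof.
elim: s l v k k' => [|y s IH] l [|b v] k k' kk' //=; first by rewrite kk'.
apply: eq_bigr => r _; apply: eq_bigr => t _; congr (_ * _).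
by apply: IH => w; rewrite kk'.
Qed.

Lemma row_weight_lin x l s v k k' u u' :
  row_weight x l s v (fun w => u * k w + u' * k' w) =
  u * row_weight x l s v k + u' * row_weight x l s v k'.
Proof.
elim: s l v k k' => [|y s IH] l [|b v] k k' //=; rewrite ?mulr0 ?addr0 //.
  by case: l; rewrite ?mulr0 ?addr0.
rewrite !sum_bool !IH; ring.
Qed.

Lemma row_weight_sum x l s v (k : bool -> bool -> seq bool -> F) (u : bool -> bool -> F) :
  row_weight x l s v (fun w => \sum_b \sum_b' u b b' * k b b' w) =
  \sum_b \sum_b' u b b' * row_weight x l s v (k b b').
Proof.
transitivity (row_weight x l s v (fun w =>
  1 * (u false false * k false false w + u false true * k false true w) +
  1 * (u true false * k true false w + u true true * k true true w))).
  by apply: eq_row_weight => w; rewrite !sum_bool; ring.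
rewrite row_weight_lin !row_weight_lin !sum_bool; ring.
Qed.

(** The crossing of the two rows has the quotient of [y * u] and [x * u] as parameter, so [u] drops
    out; [x != 0] and [x - q * y != 0] keep it off its pole. Each of the 64 choices of outer states
    is a rational identity. *)
Lemma yang_baxter x y u (r l b t r2 l2 : bool) :
  x != 0 -> x - q * y != 0 -> 1 - q * (x * u) != 0 -> 1 - q * (y * u) != 0 ->
  \sum_r1 \sum_l1 \sum_t1 bulk_weight q (y / x) r l l1 r1 *
     bulk_weight q (y * u) b r1 t1 r2 * bulk_weight q (x * u) t1 l1 t l2 =
  \sum_r1 \sum_l1 \sum_t1 bulk_weight q (x * u) b r t1 r1 *
     bulk_weight q (y * u) t1 l t l1 * bulk_weight q (y / x) r1 l1 l2 r2.
Proof.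
move=> x0 xy xu yu; rewrite !sum_bool.
case: r; case: l; case: b; case: t; case: r2; case: l2; rewrite /=.
all: by field; rewrite ?x0 ?xy ?xu ?yu.
Qed.

(** The crossing slides from the left end of the two rows to the right end, past one vertical line
    at a time. There both rows exit in state 0, which forces the crossing to be all 0, of weight
    1. *)
Lemma row_weight_swap x y s v k (r l : bool) :
  x != 0 -> x - q * y != 0 ->
  {in s, forall u, 1 - q * (x * u) != 0 /\ 1 - q * (y * u) != 0} ->
  \sum_r1 \sum_l1 bulk_weight q (y / x) r l l1 r1 *
    row_weight y r1 s v (fun w => row_weight x l1 s w k) =
  row_weight x r s v (fun w => row_weight y l s w k).
Proof.
move=> x0 xy; elim: s v k r l => [|u s IH] [|b v] k r l us.
- by rewrite !sum_bool; case: r; case: l; rewrite /= ?(mulr0, mul0r, addr0, add0r, mul1r).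
- by rewrite !sum_bool /= !(mulr0, addr0).
- by rewrite !sum_bool /= !(mulr0, addr0).
have [xu yu] := us u (mem_head _ _).
have {}IH v' k' r' l' := IH v' k' r' l'
  (fun u' us' => us u' (mem_behead (us' : u' \in behead (u :: s)))).
pose A x' y' r2 l2 t :=
  row_weight x' r2 s v (fun w => row_weight y' l2 s w (fun w' => k (t :: w'))).
have expand x' y' r1 l1 :
    row_weight x' r1 (u :: s) (b :: v) (fun w => row_weight y' l1 (u :: s) w k) =
    \sum_r2 \sum_t1 \sum_l2 \sum_t bulk_weight q (x' * u) b r1 t1 r2 *
      bulk_weight q (y' * u) t1 l1 t l2 *
      A x' y' r2 l2 t.
  rewrite /=; apply: eq_bigr => r2 _; apply: eq_bigr => t1 _.
  rewrite row_weight_sum mulr_sumr; apply: eq_bigr => l2 _.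
  by rewrite mulr_sumr; apply: eq_bigr => t _; rewrite mulrA.
rewrite expand; under eq_bigr => r1 _ do under eq_bigr => l1 _ do rewrite expand.
transitivity (\sum_r2 \sum_l2 \sum_t
  (\sum_r1 \sum_l1 \sum_t1 bulk_weight q (y / x) r l l1 r1 *
     bulk_weight q (y * u) b r1 t1 r2 * bulk_weight q (x * u) t1 l1 t l2) *
  A y x r2 l2 t).
  move: (bulk_weight q (y / x)) (bulk_weight q (y * u))
    (bulk_weight q (x * u)) (A y x) => S Ry Rx A'.
  rewrite !sum_bool; ring.
under eq_bigr => r2 _ do under eq_bigr => l2 _ do under eq_bigr => t _ do
  rewrite yang_baxter //.
under [RHS]eq_bigr => r2 _ do under eq_bigr => t1 _ do under eq_bigr => l2 _ do
  under eq_bigr => t _ do rewrite /A -IH.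
under [RHS]eq_bigr => r2 _ do under eq_bigr => t1 _ do under eq_bigr => l2 _ do
  under eq_bigr => t _ do under eq_bigr => r3 _ do under eq_bigr => l3 _ do
    rewrite -/(A y x r3 l3 t).
move: (bulk_weight q (y / x)) (bulk_weight q (y * u))
    (bulk_weight q (x * u)) (A y x) => S Ry Rx A'.
rewrite !sum_bool; ring.
Qed.

(* The crossing of the vertical lines number [i] and [i.+1], inserted below the
   rest [k] of the lattice; it moves through the lattice and out. *)
Fixpoint braid (x y : F) (i : nat) (k : seq bool -> F) (v : seq bool) : F :=
  match i, v with
  | 0, b :: d :: v' =>
      \sum_b1 \sum_d1 bulk_weight q (y / x) d b b1 d1 * k (b1 :: d1 :: v')
  | i'.+1, b :: v' => braid x y i' (fun w => k (b :: w)) v'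
  | _, _ => 0
  end.

Lemma braid_sum x y i (k : bool -> bool -> seq bool -> F) (u : bool -> bool -> F) v :
  braid x y i (fun w => \sum_b \sum_b' u b b' * k b b' w) v =
  \sum_b \sum_b' u b b' * braid x y i (k b b') v.
Proof.
have sum0 : \sum_b \sum_b' u b b' * 0 = 0 by rewrite !sum_bool !mulr0 !addr0.
elim: i k v => [|i IH] k [|b v] /=; rewrite ?sum0 //.
case: v => [|d v]; first by rewrite sum0.
by move: (bulk_weight q (y / x)) => S; rewrite !sum_bool; ring.
Qed.

Lemma yang_baxter_column x y u (b d l t t2 r2 : bool) :
  x != 0 -> x - q * y != 0 -> 1 - q * (x * u) != 0 -> 1 - q * (y * u) != 0 ->
  \sum_b1 \sum_d1 \sum_r bulk_weight q (y / x) d b b1 d1 *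
    bulk_weight q (y * u) b1 l t r * bulk_weight q (x * u) d1 r t2 r2 =
  \sum_b1 \sum_d1 \sum_r bulk_weight q (x * u) b l b1 r *
    bulk_weight q (y * u) d r d1 r2 * bulk_weight q (y / x) d1 b1 t t2.
Proof.
move=> x0 xy xu yu; rewrite !sum_bool.
case: b; case: l; case: d; case: t; case: t2; case: r2; rewrite /=.
all: by field; rewrite ?x0 ?xy ?xu ?yu.
Qed.

(** The same sliding for a crossing of two vertical lines, through one row: the lines [s1] to its
    left are passed unchanged, and [yang_baxter_column] moves it across the row. *)
Lemma row_weight_braid w x y s1 s2 l v k :
  x != 0 -> x - q * y != 0 -> 1 - q * (w * x) != 0 -> 1 - q * (w * y) != 0 ->
  row_weight w l (s1 ++ x :: y :: s2) v (braid x y (size s1) k) =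
  braid x y (size s1) (fun v' => row_weight w l (s1 ++ y :: x :: s2) v' k) v.
Proof.
move=> x0 xy wx wy; elim: s1 l v k => [|z s1 IH] l [|b v] k //=; last first.
  rewrite braid_sum; apply: eq_bigr => r _; apply: eq_bigr => t _.
  by rewrite IH.
case: v => [|d v] /=; first by rewrite !sum_bool !mulr0 !addr0.
rewrite !(mulrC w) in wx wy *.
pose A r2 t t2 := row_weight w r2 s2 v (fun v' => k [:: t, t2 & v']).
transitivity (\sum_r2 \sum_t \sum_t2
  (\sum_b1 \sum_d1 \sum_r bulk_weight q (y / x) d b b1 d1 *
    bulk_weight q (y * w) b1 l t r * bulk_weight q (x * w) d1 r t2 r2) *
  A r2 t t2); last first.
  under [RHS]eq_bigr => b1 _ do under eq_bigr => d1 _ do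
    under eq_bigr => r _ do under eq_bigr => t _ do
    under eq_bigr => r2 _ do under eq_bigr => t2 _ do rewrite -/(A r2 t t2).
  move: (bulk_weight q (y / x)) (bulk_weight q (y * w))
    (bulk_weight q (x * w)) A => S Ry Rx A.
  rewrite !sum_bool; ring.
under [RHS]eq_bigr => r2 _ do under eq_bigr => t _ do
  under eq_bigr => t2 _ do rewrite yang_baxter_column //.
under eq_bigr => r _ do under eq_bigr => b1 _ do
  under eq_bigr => r2 _ do under eq_bigr => d1 _ do rewrite row_weight_sum.
under eq_bigr => r _ do under eq_bigr => b1 _ do
  under eq_bigr => r2 _ do under eq_bigr => d1 _ do
  under eq_bigr => t _ do under eq_bigr => t2 _ do rewrite -/(A r2 t t2).
move: (bulk_weight q (y / x)) (bulk_weight q (y * w))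
    (bulk_weight q (x * w)) A => S Ry Rx A.
rewrite !sum_bool; ring.
Qed.

(** * Reflection equation and symmetry of the lattice *)

Definition corner x y (b d r l : bool) : F :=
  \sum_l1 \sum_t boundary_weight a c x b l1 * bulk_weight q (x * y) d l1 t r *
    boundary_weight a c y t l.

(** The boundary Yang-Baxter equation: a crossing of the two upward lines below their turns becomes
    a crossing of the two rows behind the turns, with the same parameter [y / x]. *)
Lemma reflection x y (b d r l : bool) :
  a != 0 -> c != 0 -> x != 0 -> x - q * y != 0 -> 1 - q * (x * y) != 0 ->
  a - x != 0 -> c - x != 0 -> a - y != 0 -> c - y != 0 ->
  \sum_b1 \sum_d1 bulk_weight q (y / x) d b b1 d1 * corner y x b1 d1 r l =
  \sum_r1 \sum_l1 corner x y b d r1 l1 * bulk_weight q (y / x) r1 l1 l r.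
Proof.
move=> a0 c0 x0 xy qxy ax cx ay cy; rewrite /corner (mulrC y x) !sum_bool.
case: b; case: d; case: r; case: l; rewrite /= /hfun.
all: by field; rewrite ?a0 ?c0 ?x0 ?xy ?qxy ?ax ?cx ?ay ?cy.
Qed.

Lemma row_weight_sum1 x l s v (k : bool -> seq bool -> F) (u : bool -> F) :
  row_weight x l s v (fun w => \sum_b u b * k b w) = \sum_b u b * row_weight x l s v (k b).
Proof.
rewrite sum_bool -row_weight_lin; apply: eq_row_weight => w; exact: sum_bool.
Qed.

Lemma braid_sum1 x y i (k : bool -> seq bool -> F) (u : bool -> F) v :
  braid x y i (fun w => \sum_b u b * k b w) v = \sum_b u b * braid x y i (k b) v.
Proof.
elim: i k v => [|i IH] k [|b v] //=; rewrite ?sum_bool ?mulr0 ?addr0 //.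
case: v => [|d v]; first by rewrite !mulr0 addr0.
by move: (bulk_weight q (y / x)) => S; rewrite !sum_bool; ring.
Qed.

(** The inserted crossing climbs through the rows of [s1] ([row_weight_braid]), passes the two turns
    ([reflection]) and leaves to the right between the rows of [x] and [y] ([row_weight_swap]). *)
Lemma lattice_braid x y s1 s2 v :
  a != 0 -> c != 0 -> x != 0 -> x - q * y != 0 -> 1 - q * (x * y) != 0 ->
  a - x != 0 -> c - x != 0 -> a - y != 0 -> c - y != 0 ->
  {in s1 ++ s2, forall u, 1 - q * (x * u) != 0 /\ 1 - q * (y * u) != 0} ->
  lattice (s1 ++ x :: y :: s2) v =
  braid x y (size s1) (lattice (s1 ++ y :: x :: s2)) v.
Proof.
move=> a0 c0 x0 xy qxy ax cx ay cy; elim: s1 v => [|w s1 IH] v us; last first.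
  case: v => [|b v] //=; rewrite braid_sum1; apply: eq_bigr => l _.
  have [wx wy] := us w (mem_head _ _).
  congr (_ * _); rewrite -row_weight_braid // 1?(mulrC w) //; apply: eq_row_weight => v'.
  by apply: IH => u us1; apply: us; rewrite inE us1 orbT.
case: v => [|b [|d v]] //=; first by rewrite !sum_bool !mulr0 addr0.
have base x' y' b' d' :
    \sum_l boundary_weight a c x' b' l * (\sum_r \sum_t
      bulk_weight q (x' * y') d' l t r * row_weight x' r s2 v (fun w =>
        \sum_l' boundary_weight a c y' t l' * row_weight y' l' s2 w (lattice s2))) =
    \sum_r \sum_l corner x' y' b' d' r l *
      row_weight x' r s2 v (fun w => row_weight y' l s2 w (lattice s2)).
  under eq_bigr => l _ do under eq_bigr => r _ do
    under eq_bigr => t _ do rewrite row_weight_sum1.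
  pose T r l := row_weight x' r s2 v (fun w => row_weight y' l s2 w (lattice s2)).
  under eq_bigr => l _ do under eq_bigr => r _ do
    under eq_bigr => t _ do under eq_bigr => l' _ do rewrite -/(T r l').
  under [RHS]eq_bigr => r _ do under eq_bigr => l _ do rewrite -/(T r l).
  rewrite /corner; move: (bulk_weight q (x' * y')) (boundary_weight a c x')
    (boundary_weight a c y') T => R K K' T.
  rewrite !sum_bool; ring.
rewrite base; under [RHS]eq_bigr => b1 _ do under eq_bigr => d1 _ do rewrite base.
under [LHS]eq_bigr => r _ do under eq_bigr => l _ do
  rewrite -(@row_weight_swap x y s2 v (lattice s2) r l) //.
pose T r l := row_weight y r s2 v (fun w => row_weight x l s2 w (lattice s2)).
transitivity (\sum_r \sum_l (\sum_b1 \sum_d1 bulk_weight q (y / x) d b b1 d1 *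
  corner y x b1 d1 r l) * T r l).
  under [RHS]eq_bigr => r _ do under eq_bigr => l _ do rewrite reflection //.
  under eq_bigr => r _ do under eq_bigr => l _ do
    under eq_bigr => r1 _ do under eq_bigr => l1 _ do rewrite -/(T r1 l1).
  move: (bulk_weight q (y / x)) corner T => S M T.
  rewrite !sum_bool; ring.
under [RHS]eq_bigr => b1 _ do under eq_bigr => d1 _ do
  under eq_bigr => r _ do under eq_bigr => l _ do rewrite -/(T r l).
move: (bulk_weight q (y / x)) corner T => S M T.
rewrite !sum_bool; ring.
Qed.

Definition Zlat s := lattice s (nseq (size s) false).

Lemma braid_nseq x y i k n :
  (i.+1 < n)%N -> braid x y i k (nseq n false) = k (nseq n false).
Proof.
elim: i k n => [|i IH] k [|[|n]] //= lt_in; last exact: (IH _ n.+1).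
rewrite !sum_bool /=; ring.
Qed.

(** With all entrances in state 0 the inserted crossing is all 0 and has weight 1, so it can be
    added for free. *)
Lemma Zlat_swap x y s1 s2 :
  a != 0 -> c != 0 -> x != 0 -> x - q * y != 0 -> 1 - q * (x * y) != 0 ->
  a - x != 0 -> c - x != 0 -> a - y != 0 -> c - y != 0 ->
  {in s1 ++ s2, forall u, 1 - q * (x * u) != 0 /\ 1 - q * (y * u) != 0} ->
  Zlat (s1 ++ x :: y :: s2) = Zlat (s1 ++ y :: x :: s2).
Proof.
move=> a0 c0 x0 xy qxy ax cx ay cy us.
rewrite /Zlat lattice_braid // braid_nseq size_cat /=; first by rewrite size_cat.
by rewrite !addnS !ltnS leq_addr.
Qed.

Lemma row_weight_nseq x s k :
  row_weight x false s (nseq (size s) false) k = k (nseq (size s) false).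
Proof.
elim: s k => [|y s IH] k //=; rewrite !sum_bool /= !IH; ring.
Qed.

(** Since h(0) = 1, K_0(0;0) = 0 and the line turns right in state 1. At parameter 0 the weight of
    (0,1,1,0) vanishes, so a row in state 1 stays in it and cannot exit in state 0. *)
Lemma Zlat0 s : a != 0 -> c != 0 -> Zlat (0 :: s) = 0.
Proof.
move=> a0 c0.
have row0 : forall k v, size v = size s -> row_weight 0 true s v k = 0.
  elim: s => [|y s IH] k [|b v] //= [sv].
  by rewrite !sum_bool !IH //; case: b; rewrite /=; ring.
rewrite /Zlat /= sum_bool row0 ?size_nseq // row_weight_nseq /= /hfun; field.
by rewrite a0 c0.
Qed.

Lemma Zlat_sqr1 x s : x ^+ 2 = 1 -> Zlat (x :: s) = Zlat s.
Proof.
move=> x1; have h0 : hfun a c x = 0 by rewrite /hfun x1 subrr mulr0 mul0r.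
rewrite /Zlat /= sum_bool row_weight_nseq /= h0; ring.
Qed.

(** For [q != 1], R_1 sends the left state to the top and the bottom state to the right. So the
    state behind the first turn goes on into the second boundary vertex, while the entrance 0 of the
    second line runs along the first row with weight 1. The conditions on [a * x - 1] and
    [c * x - 1] keep h off its poles at [x^-1]. *)
Lemma Zlat_inv x s : a != 0 -> c != 0 -> x != 0 -> q != 1 ->
  a - x != 0 -> c - x != 0 -> a * x - 1 != 0 -> c * x - 1 != 0 ->
  Zlat (x^-1 :: x :: s) = Zlat s.
Proof.
move=> a0 c0 x0 q1 ax cx ax1 cx1.
have q1' : 1 - q != 0 by rewrite subr_eq0 eq_sym.
pose T l := row_weight x l s (nseq (size s) false) (lattice s).
transitivity (\sum_l boundary_weight a c x^-1 false l *
  (\sum_l' boundary_weight a c x l l' * T l')).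
  rewrite /Zlat /=; apply: eq_bigr => l _; congr (_ * _).
  rewrite mulVf // !sum_bool; case: l => /=;
    rewrite !row_weight_nseq ?mulr1 ?subrr ?mul1r ?divff // /T !sum_bool /=; ring.
rewrite /T /Zlat !sum_bool row_weight_nseq /= /hfun; field.
by rewrite c0 a0 cx ax x0 cx1 ax1.
Qed.

End Lattice.

(** * Identities of rational functions in one variable *)

Section Generic.
Variable F : numFieldType.

(* [P] holds outside the zeros of a nonzero polynomial. *)
Definition generic (P : F -> Prop) : Prop :=
  exists2 b : {poly F}, b != 0 & forall t, b.[t] != 0 -> P t.

(** [p * b] vanishes everywhere, hence at more natural numbers than its degree; these are distinct
    in characteristic 0. *)
Lemma poly_eq0_generic (p : {poly F}) : generic (fun t => p.[t] = 0) -> p = 0.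
Proof.
case=> b b0 pb; apply/eqP; apply: contraT => p0.
have pb0 : p * b != 0 by rewrite mulf_neq0.
pose rs : seq F := [seq i%:R | i <- iota 0 (size (p * b))].
have := max_poly_roots pb0 (rs := rs); rewrite size_map size_iota ltnn => -> //.
  apply/allP => _ /mapP [i _ ->]; rewrite rootM /root.
  by have [_ | /pb ->] := eqVneq b.[i%:R] 0; rewrite ?eqxx ?orbT.
by rewrite map_inj_uniq ?iota_uniq // => i j /eqP; rewrite eqr_nat => /eqP.
Qed.

Lemma generic_all (P : F -> Prop) : (forall t, P t) -> generic P.
Proof. by exists 1 => //; rewrite oner_eq0. Qed.

Lemma generic_poly (p : {poly F}) : p != 0 -> generic (fun t => p.[t] != 0).
Proof. by exists p. Qed.

Lemma generic_and (P Q : F -> Prop) :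
  generic P -> generic Q -> generic (fun t => P t /\ Q t).
Proof.
case=> b b0 Pb [d d0 Qd]; exists (b * d); first by rewrite mulf_neq0.
by move=> t; rewrite hornerM mulf_eq0 negb_or => /andP[/Pb ? /Qd ?].
Qed.

Lemma generic_sub (P Q : F -> Prop) : (forall t, P t -> Q t) -> generic P -> generic Q.
Proof. by move=> PQ [b b0 Pb]; exists b => // t /Pb /PQ. Qed.

Lemma generic_in (T : eqType) (s : seq T) (P : T -> F -> Prop) :
  {in s, forall x, generic (P x)} -> generic (fun t => {in s, forall x, P x t}).
Proof.
elim: s => [|x s IH] Ps; first exact: generic_all.
have Pss := IH (fun y ys => Ps y (mem_behead (ys : y \in behead (x :: s)))).
apply: generic_sub (generic_and (Ps x (mem_head _ _)) Pss) => t [Px Pst] y.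
by rewrite inE => /predU1P[-> | /Pst].
Qed.

(** The equation holds at [t0] too, so [f t0] is the true value of the rational function and not an
    artefact of division by 0. *)
Definition regular_at (t0 : F) (f : F -> F) : Prop :=
  exists p d : {poly F}, d.[t0] != 0 /\ forall t, d.[t] != 0 -> f t = p.[t] / d.[t].

Lemma regular_horner t0 (p : {poly F}) : regular_at t0 (fun t => p.[t]).
Proof.
by exists p, 1; split=> [|t _]; rewrite hornerC ?oner_eq0 // divr1.
Qed.

Lemma eq_regular t0 f g : f =1 g -> regular_at t0 f -> regular_at t0 g.
Proof. by move=> fg [p [d [d0 fE]]]; exists p, d; split=> // t /fE <-. Qed.

Lemma regular_const t0 k : regular_at t0 (fun=> k).
Proof. by apply: eq_regular (regular_horner t0 k%:P) => t; rewrite hornerC. Qed.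

Lemma regular_id t0 : regular_at t0 id.
Proof. by apply: eq_regular (regular_horner t0 'X) => t; rewrite hornerX. Qed.

Lemma regular_add t0 f g : regular_at t0 f -> regular_at t0 g ->
  regular_at t0 (fun t => f t + g t).
Proof.
move=> [p [d [d0 fE]]] [p' [d' [d0' gE]]]; exists (p * d' + p' * d), (d * d').
split=> [|t]; first by rewrite hornerM mulf_neq0.
rewrite hornerM mulf_eq0 negb_or => /andP[dt dt'].
rewrite fE // gE // hornerD !hornerM; field; exact/andP.
Qed.

Lemma regular_mul t0 f g : regular_at t0 f -> regular_at t0 g ->
  regular_at t0 (fun t => f t * g t).
Proof.
move=> [p [d [d0 fE]]] [p' [d' [d0' gE]]]; exists (p * p'), (d * d').
split=> [|t]; first by rewrite hornerM mulf_neq0.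
rewrite hornerM mulf_eq0 negb_or => /andP[dt dt'].
rewrite fE // gE // !hornerM; field; exact/andP.
Qed.

Lemma regular_opp t0 f : regular_at t0 f -> regular_at t0 (fun t => - f t).
Proof.
move=> [p [d [d0 fE]]]; exists (- p), d; split=> // t dt.
by rewrite fE // hornerN mulNr.
Qed.

Lemma regular_sub t0 f g : regular_at t0 f -> regular_at t0 g ->
  regular_at t0 (fun t => f t - g t).
Proof. by move=> fr gr; apply: regular_add => //; apply: regular_opp. Qed.

Lemma regular_inv t0 f : regular_at t0 f -> f t0 != 0 ->
  regular_at t0 (fun t => (f t)^-1).
Proof.
move=> [p [d [d0 fE]]]; rewrite fE // mulf_eq0 negb_or => /andP[p0 _].
exists (d ^+ 2), (p * d); split=> [|t]; first by rewrite hornerM mulf_neq0.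
rewrite hornerM mulf_eq0 negb_or => /andP[pt dt]; rewrite fE // horner_exp; field.
by rewrite pt dt.
Qed.

Lemma regular_div t0 f g : regular_at t0 f -> regular_at t0 g -> g t0 != 0 ->
  regular_at t0 (fun t => f t / g t).
Proof. by move=> fr gr g0; apply: regular_mul => //; apply: regular_inv. Qed.

Lemma regular_exp t0 f n : regular_at t0 f -> regular_at t0 (fun t => f t ^+ n).
Proof.
move=> fr; elim: n => [|n IH]; first exact: regular_const.
by apply: eq_regular (regular_mul fr IH) => t; rewrite exprS.
Qed.

Lemma regular_sum t0 (I : Type) (r : seq I) (P : pred I) (f : I -> F -> F) :
  (forall i, P i -> regular_at t0 (f i)) ->
  regular_at t0 (fun t => \sum_(i <- r | P i) f i t).
Proof.
move=> fr; elim: r => [|i r IH].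
  by apply: eq_regular (regular_const t0 0) => t; rewrite big_nil.
have [Pi | nPi] := boolP (P i).
  by apply: eq_regular (regular_add (fr i Pi) IH) => t; rewrite big_cons Pi.
by apply: eq_regular IH => t; rewrite big_cons (negPf nPi).
Qed.

Lemma regular_prod t0 (I : Type) (r : seq I) (P : pred I) (f : I -> F -> F) :
  (forall i, P i -> regular_at t0 (f i)) ->
  regular_at t0 (fun t => \prod_(i <- r | P i) f i t).
Proof.
move=> fr; elim: r => [|i r IH].
  by apply: eq_regular (regular_const t0 1) => t; rewrite big_nil.
have [Pi | nPi] := boolP (P i).
  by apply: eq_regular (regular_mul (fr i Pi) IH) => t; rewrite big_cons Pi.
by apply: eq_regular IH => t; rewrite big_cons (negPf nPi).
Qed.

(** This replaces a limit argument: the numerator of the difference vanishes generically, hence is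
    the zero polynomial. *)
Lemma regular_eq t0 f g : regular_at t0 f -> regular_at t0 g ->
  generic (fun t => f t = g t) -> f t0 = g t0.
Proof.
move=> fr gr fg; apply/eqP; rewrite -subr_eq0; apply/eqP.
have [p [d [d0 hE]]] := regular_sub fr gr; rewrite hE //.
rewrite (poly_eq0_generic (p := p)) ?horner0 ?mul0r //.
have dn0 : d != 0 by apply: contraNneq d0 => ->; rewrite horner0.
apply: generic_sub (generic_and fg (generic_poly dn0)) => t [fgt dt].
have /eqP := hE t dt; rewrite fgt subrr eq_sym mulf_eq0 invr_eq0 (negPf dt) orbF.
by move/eqP.
Qed.

(** Agreement is only generic because a cleared denominator still yields a junk value at its own
    zeros. *)
Definition poly_generic (d : nat) (f : F -> F) : Prop :=
  exists2 p : {poly F}, (size p <= d.+1)%N & generic (fun t => f t = p.[t]).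

Lemma poly_generic_eq d f g : generic (fun t => f t = g t) ->
  poly_generic d f -> poly_generic d g.
Proof.
move=> fg [p pd fp]; exists p => //.
by apply: generic_sub (generic_and fg fp) => t [<-].
Qed.

Lemma poly_generic_le d d' f : (d <= d')%N -> poly_generic d f -> poly_generic d' f.
Proof. by move=> dd' [p pd fp]; exists p => //; apply: leq_trans pd _. Qed.

Lemma poly_generic_const k : poly_generic 0 (fun=> k).
Proof.
exists k%:P; first exact: size_polyC_leq1.
by apply: generic_all => t; rewrite hornerC.
Qed.

Lemma poly_generic_lin u v : poly_generic 1 (fun t => u + v * t).
Proof.
exists (u%:P + v *: 'X); last by apply: generic_all => t; rewrite !hornerE.
rewrite (leq_trans (size_polyD _ _)) // geq_max (leq_trans (size_polyC_leq1 _)) //.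
by rewrite (leq_trans (size_scale_leq _ _)) // size_polyX.
Qed.

Lemma poly_generic_add d f g : poly_generic d f -> poly_generic d g ->
  poly_generic d (fun t => f t + g t).
Proof.
move=> [p pd fp] [p' pd' gp']; exists (p + p').
  by rewrite (leq_trans (size_polyD _ _)) // geq_max pd.
by apply: generic_sub (generic_and fp gp') => t [-> ->]; rewrite hornerD.
Qed.

Lemma poly_generic_mul d d' f g : poly_generic d f -> poly_generic d' g ->
  poly_generic (d + d') (fun t => f t * g t).
Proof.
move=> [p pd fp] [p' pd' gp']; exists (p * p').
  rewrite (leq_trans (size_polyMleq _ _)) //.
  by rewrite -subn1 leq_subLR (leq_trans (leq_add pd pd')) // addnS addSn.
by apply: generic_sub (generic_and fp gp') => t [-> ->]; rewrite hornerM.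
Qed.

Lemma poly_generic_sum d (I : Type) (r : seq I) (P : pred I) (f : I -> F -> F) :
  (forall i, P i -> poly_generic d (f i)) ->
  poly_generic d (fun t => \sum_(i <- r | P i) f i t).
Proof.
move=> fd; elim: r => [|i r IH].
  apply: poly_generic_eq (poly_generic_le (leq0n d) (poly_generic_const 0)).
  by apply: generic_all => t; rewrite big_nil.
have [Pi | nPi] := boolP (P i).
  apply: poly_generic_eq (poly_generic_add (fd i Pi) IH).
  by apply: generic_all => t; rewrite big_cons Pi.
apply: poly_generic_eq IH.
by apply: generic_all => t; rewrite big_cons (negPf nPi).
Qed.

End Generic.

(** * Pfaffians *)

Lemma sum_lift_perm (V : nmodType) n (i : 'I_n.+1) (f : 'S_n.+1 -> V) :
  \sum_s f s = \sum_j \sum_(u : 'S_n) f (lift_perm i j u).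
Proof.
rewrite pair_big /= (reindex (fun p : 'I_n.+1 * 'S_n => lift_perm i p.1 p.2)) //.
apply: onW_bij; apply: inj_card_bij; last first.
  by rewrite card_prod card_ord !card_Sn factS.
move=> [j u] [j' u'] /= eq_lift.
have jj' : j = j' by rewrite -(lift_perm_id i j u) eq_lift lift_perm_id.
congr (_, _) => //; apply/permP => k; apply: (@lift_inj _ j).
by rewrite -(lift_perm_lift i) eq_lift lift_perm_lift jj'.
Qed.

Section Pfaffian.
Variable F : numFieldType.

Definition pf_term m (A : 'M[F]_m) (s : 'S_m) : F :=
  (-1) ^+ s * \prod_(i < m | ~~ odd i) A (s i) (s (ordS i)).

Lemma val_ordS m (i : 'I_m) : (i.+1 < m)%N -> ordS i = i.+1 :> nat.
Proof. by move=> lt_im; rewrite /= modn_small. Qed.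

Lemma even_ltnS m (i : 'I_m) : ~~ odd m -> ~~ odd i -> (i.+1 < m)%N.
Proof.
move=> em ei; rewrite ltn_neqAle ltn_ord andbT.
by apply: contraNneq em => <-; rewrite /= ei.
Qed.

Lemma pf_term_perm m (A : 'M[F]_m) (t s : 'S_m) :
  pf_term (\matrix_(i, j) A (t i) (t j)) s = (-1) ^+ t * pf_term A (s * t).
Proof.
rewrite /pf_term odd_permM signr_addb -!mulrA [RHS]mulrCA signrMK.
by congr (_ * _); apply: eq_bigr => i _; rewrite mxE !permM.
Qed.

Lemma pfaffian_perm m (A : 'M[F]_m) (t : 'S_m) :
  pfaffian (\matrix_(i, j) A (t i) (t j)) = (-1) ^+ t * pfaffian A.
Proof.
rewrite /pfaffian mulrCA; congr (_ * _).
rewrite [in RHS](reindex_inj (mulIg t)) big_distrr; apply: eq_bigr => s _.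
exact: pf_term_perm.
Qed.

Lemma pf_term_swap_pair m (A : 'M[F]_m) (k : 'I_m) s :
  (forall i j, A i j = - A j i) -> ~~ odd m -> ~~ odd k ->
  pf_term A (tperm k (ordS k) * s) = pf_term A s.
Proof.
move=> skewA em ek; have kS := val_ordS (even_ltnS em ek).
have kneq : k != ordS k.
  by apply/eqP => /(congr1 (@nat_of_ord m)) /eqP; rewrite kS ltn_eqF.
rewrite /pf_term odd_permM odd_tperm kneq signr_addb expr1 mulN1r mulNr -mulrN.
congr (_ * _); rewrite (bigD1 k) //= [in RHS](bigD1 k) //= !permM tpermL tpermR.
rewrite skewA mulNr opprK; congr (_ * _); apply: eq_bigr => i /andP[ei nik].
have iS := val_ordS (even_ltnS em ei).
rewrite !permM !tpermD // ?(inj_eq (@ordS_inj m)) 1?eq_sym //.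
  by apply: contraNneq ek => <-; rewrite iS.
by apply: contraNneq ei => ->; rewrite kS.
Qed.

Lemma pf_term_swap_pairs m (A : 'M[F]_m) (k l : 'I_m) s :
  ~~ odd m -> ~~ odd k -> ~~ odd l -> k != l ->
  pf_term A (tperm k l * tperm (ordS k) (ordS l) * s) = pf_term A s.
Proof.
move=> em ek el kl; have kS := val_ordS (even_ltnS em ek).
have lS := val_ordS (even_ltnS em el).
have kSl : ordS k != ordS l by rewrite (inj_eq (@ordS_inj m)).
have even_neq (i j : 'I_m) : ~~ odd i -> ~~ odd j -> ordS i != j.
  move=> ei ej; apply: contraNneq ej => <-.
  by rewrite (val_ordS (even_ltnS em ei)) /= ei.
rewrite /pf_term !odd_permM !odd_tperm kl kSl addbb addFb; congr (_ * _).
rewrite [in RHS](reindex_inj (@perm_inj _ (tperm k l))) /=.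
apply: eq_big => [i|i ei]; first by case: tpermP => [->|->|]; rewrite ?ek ?el.
rewrite !permM.
rewrite (_ : tperm (ordS k) (ordS l) (tperm k l i) = tperm k l i); last first.
  by case: (tpermP k l i) => *; rewrite tpermD ?even_neq.
congr (A _ (s _)); rewrite [tperm k l (ordS i)]tpermD 1?eq_sym ?even_neq //.
have [ik | ik] := eqVneq i k; first by rewrite ik !tpermL.
have [il | il] := eqVneq i l; first by rewrite il !tpermR.
by rewrite !tpermD // 1?(inj_eq (@ordS_inj m)) // eq_sym.
Qed.

(** Permutations are grouped by the position that is sent to 0, and all groups have the same sum. An
    exchange inside a pair flips the sign of the permutation and of one entry; an exchange of two
    pairs is even and permutes the factors. *)
Lemma sum_pf_term n (A : 'M[F]_n.+2) : ~~ odd n -> (forall i j, A i j = - A j i) ->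
  \sum_s pf_term A s = n.+2%:R * \sum_(u : 'S_n.+1) pf_term A (lift_perm ord0 ord0 u).
Proof.
move=> en skewA.
pose T (k : 'I_n.+2) := \sum_(s : 'S_n.+2 | s k == ord0) pf_term A s.
have em : ~~ odd n.+2 by rewrite /= negbK.
have T_pair (k : 'I_n.+2) : ~~ odd k -> T (ordS k) = T k.
  move=> ek; rewrite /T (reindex_inj (mulgI (tperm k (ordS k)))) /=.
  apply: eq_big => s; first by rewrite permM tpermR.
  by rewrite pf_term_swap_pair.
have T_even (k : 'I_n.+2) : ~~ odd k -> T k = T ord0.
  move=> ek; have [-> // | k0] := eqVneq k ord0.
  rewrite /T (reindex_inj (mulgI (tperm k ord0 * tperm (ordS k) (ordS ord0))%g)) /=.
  apply: eq_big => s; last by rewrite pf_term_swap_pairs.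
  rewrite !permM tpermL tpermD //.
  by apply/eqP => /(congr1 (@nat_of_ord _)); rewrite (val_ordS (even_ltnS em ek)).
have T0 (k : 'I_n.+2) : T k = T ord0.
  have [ok | ek] := boolP (odd k); last exact: T_even.
  have k0 : (0 < k)%N by case: (nat_of_ord k) ok.
  have ltk : (k.-1 < n.+2)%N by apply: leq_ltn_trans (leq_pred _) (ltn_ord k).
  have kE : k = ordS (Ordinal ltk) by apply: val_inj; rewrite /= prednK // modn_small.
  have ek : ~~ odd (Ordinal ltk) by rewrite /= -oddS prednK // negbK.
  by rewrite kE T_pair // T_even.
rewrite (partition_big (fun s : 'S_n.+2 => (s^-1)%g ord0) predT) //=.
transitivity (\sum_(k < n.+2) T ord0).
  apply: eq_bigr => k _; rewrite -(T0 k); apply: eq_bigl => s.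
  by rewrite (can2_eq (permKV s) (permK s)) eq_sym.
rewrite sumr_const card_ord -[LHS]mulr_natl; congr (_ * _).
rewrite /T big_mkcond (sum_lift_perm ord0) /= (bigD1 ord0) //= [X in _ + X]big1.
  by rewrite addr0; apply: eq_bigr => u _; rewrite lift_perm_id eqxx.
move=> j j0; apply: big1 => u _; by rewrite lift_perm_id (negPf j0).
Qed.

Lemma pf_term_lift n (A : 'M[F]_n.+2) (j : 'I_n.+1) (w : 'S_n) : ~~ odd n ->
  pf_term A (lift_perm ord0 ord0 (lift_perm ord0 j w)) =
  (-1) ^+ j * A ord0 (lift ord0 j) *
    pf_term (\matrix_(i, k) A (lift ord0 (lift j i)) (lift ord0 (lift j k))) w.
Proof.
move=> en; have em : ~~ odd n.+2 by rewrite /= negbK.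
have S0 : ordS (@ord0 n.+1) = lift ord0 ord0 by apply: val_inj.
rewrite /pf_term !odd_lift_perm /= signr_addb signr_odd -!mulrA; congr (_ * _).
rewrite mulrCA; congr (_ * _).
rewrite big_mkcond !big_ord_recl /= S0 lift_perm_id !lift_perm_lift lift_perm_id mul1r.
congr (_ * _); rewrite [in RHS]big_mkcond; apply: eq_bigr => i _.
rewrite /= /bump /= ?add1n /= !negbK; case: ifP => // ei.
have iS : ordS (lift ord0 (lift ord0 i)) = lift ord0 (lift ord0 (ordS i)) :> 'I_n.+2.
  apply: val_inj; rewrite /= /bump /= !add1n.
  have lti := even_ltnS en ei; by rewrite !modn_small.
by rewrite iS !lift_perm_lift mxE.
Qed.

Lemma pfaffian_expand n (A : 'M[F]_n.+2) : ~~ odd n -> (forall i j, A i j = - A j i) ->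
  pfaffian A = \sum_(j < n.+1) (-1) ^+ j * A ord0 (lift ord0 j) *
    pfaffian (\matrix_(i, k) A (lift ord0 (lift j i)) (lift ord0 (lift j k))).
Proof.
move=> en skewA; rewrite /pfaffian; under [RHS]eq_bigr => j _ do rewrite mulrCA.
rewrite -big_distrr /= [X in _ * X](_ : _ = \sum_s pf_term A s) // sum_pf_term //.
rewrite mulrA; congr (_ * _).
  (* The normalisations in sizes n + 2 and n differ by the factor 2 (n/2 + 1) = n + 2, which cancels
     the one from [sum_pf_term]. *)
  have -> : n.+2%:R = 2 * n./2.+1%:R :> F.
    by rewrite -natrM mul2n doubleS -[in LHS](odd_double_half n) (negPf en).
  rewrite expnS factS !natrM; field.
  by rewrite !pnatr_eq0 -!lt0n expn_gt0 fact_gt0 -[1 in X in _ && X]/(1%:R) -natrD pnatr_eq0.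
rewrite (sum_lift_perm ord0); apply: eq_bigr => j _.
by rewrite big_distrr; apply: eq_bigr => w _; rewrite pf_term_lift.
Qed.

Variables (T : eqType) (x0 : T) (mu : T -> T -> F).
Hypothesis skew : forall p r, mu p r = - mu r p.

Definition pf_seq n (f : nat -> T) : F := pfaffian (\matrix_(i < n, j < n) mu (f i) (f j)).

Lemma eq_pf_seq n f g : (forall i, (i < n)%N -> f i = g i) -> pf_seq n f = pf_seq n g.
Proof.
by move=> fg; congr pfaffian; apply/matrixP => i j; rewrite !mxE !fg.
Qed.

Lemma pf_seq_expand n f : ~~ odd n ->
  pf_seq n.+2 f = \sum_(j < n.+1) (-1) ^+ j * mu (f 0) (f j.+1) *
    pf_seq n (fun i => f (bump j i).+1).
Proof.
move=> en; rewrite /pf_seq pfaffian_expand //; last by move=> i j; rewrite !mxE.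
apply: eq_bigr => j _; rewrite !mxE !lift0; congr (_ * _); congr pfaffian.
by apply/matrixP => i k; rewrite !mxE !lift0.
Qed.

(** Rows are named by labels, so that deleting and exchanging rows are operations on lists and a
    label may be repeated. *)
Definition Pf (t : seq T) : F := pf_seq (size t) (nth x0 t).

Lemma Pf_nil : Pf [::] = 1.
Proof.
rewrite /Pf /pf_seq /pfaffian expn0 mul1n invr1 mul1r (bigD1 1%g) //= [X in _ + X]big1.
  by rewrite odd_perm1 big_ord0 mulr1 addr0.
by move=> s /eqP[]; apply/permP => -[].
Qed.

Definition delete (j : nat) (t : seq T) := take j t ++ drop j.+1 t.

Lemma Pf_expand p t : odd (size t) ->
  Pf (p :: t) = \sum_(j < size t) (-1) ^+ j * mu p (nth x0 t j) * Pf (delete j t).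
Proof.
case: t => [|p' t] //= en; rewrite {1}/Pf [size _]/= pf_seq_expand //.
apply: eq_bigr => j _; congr (_ * _ * _); rewrite /Pf /delete.
have sz_take : size (take j (p' :: t)) = j by rewrite size_takel //= ltnW.
have -> : size (take j (p' :: t) ++ drop j.+1 (p' :: t)) = size t.
  by rewrite size_cat sz_take size_drop /= subSS subnKC // -ltnS.
apply: eq_pf_seq => i lti; rewrite nth_cat sz_take /bump.
by case: ltnP => ij; [rewrite nth_take | rewrite nth_drop addSn subnKC].
Qed.

Lemma Pf_swap t1 p r t2 : Pf (t1 ++ p :: r :: t2) = - Pf (t1 ++ r :: p :: t2).
Proof.
rewrite /Pf !size_cat /=; set n := (_ + _)%N.
have lt1 : (size t1 < n)%N by rewrite /n !addnS ltnS leqW // leq_addr.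
have lt2 : ((size t1).+1 < n)%N by rewrite /n !addnS !ltnS leq_addr.
pose i1 := Ordinal lt1; pose i2 := Ordinal lt2.
have ne12 : i1 != i2 by rewrite -val_eqE /= ltn_eqF.
transitivity (pfaffian (\matrix_(i < n, j < n)
  (\matrix_(i < n, j < n) mu (nth x0 (t1 ++ r :: p :: t2) i)
     (nth x0 (t1 ++ r :: p :: t2) j)) (tperm i1 i2 i) (tperm i1 i2 j))).
  have nthE (i : 'I_n) : nth x0 (t1 ++ p :: r :: t2) i =
      nth x0 (t1 ++ r :: p :: t2) (tperm i1 i2 i).
    case: tpermP => [->|->|/eqP i1n /eqP i2n] /=.
    - by rewrite !nth_cat ltnn subnn ltnNge leqnSn subSnn.
    - by rewrite !nth_cat ltnn subnn ltnNge leqnSn subSnn.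
    rewrite !nth_cat; case: ltnP => // le1.
    case: (ltngtP i (size t1)) le1 => // [lt|eq] _; last first.
      by case/eqP: i1n; apply: val_inj.
    have : (size t1).+1 != i.
      by apply: contra i2n => /eqP ii; apply/eqP/val_inj.
    rewrite neq_ltn => /orP[lt'|]; last by rewrite ltnS leqNgt lt.
    by rewrite -(subnSK lt) -(subnSK lt').
  by congr pfaffian; apply/matrixP => i j; rewrite !mxE !nthE.
by rewrite pfaffian_perm odd_tperm ne12 expr1 mulN1r.
Qed.

(** Exchanges bring the two copies of [p] together; exchanging these gives Pf = - Pf, which forces 0
    in characteristic 0. *)
Lemma Pf_repeat t1 p t2 t3 : Pf (t1 ++ p :: t2 ++ p :: t3) = 0.
Proof.
elim: t2 t1 => [|r t2 IH] t1 /=; last by rewrite Pf_swap -cat_rcons IH oppr0.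
apply/eqP; have /eqP := Pf_swap t1 p p t3.
by rewrite -addr_eq0 -mulr2n mulrn_eq0.
Qed.

(* Replacing [mu p r] by 0 would make row [p] a multiple of row [r]. *)
Lemma Pf_twin k p r t : ~~ odd (size t) -> {in t, forall y, mu p y = k * mu r y} ->
  Pf (p :: r :: t) = mu p r * Pf t.
Proof.
move=> et twin; have mu0 : mu r r = 0.
  by apply/eqP; have /eqP := skew r r; rewrite -addr_eq0 -mulr2n mulrn_eq0.
(* The vanishing expansion of the Pfaffian with row [r] twice, times [k], consists of all terms of
   the left side except the first. *)
have := Pf_repeat [::] r [::] t; rewrite /= !Pf_expand //= !big_ord_recl /=.
rewrite /delete /= !drop0 expr0 mu0 mulr0 mul0r add0r => sum0.
rewrite mul1r -[RHS]addr0; congr (_ + _).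
rewrite -[RHS](mulr0 k) -[in RHS]sum0 mulr_sumr.
apply: eq_bigr => j _; rewrite add0n twin ?mem_nth //.
ring.
Qed.

End Pfaffian.

(** * Degree bounds *)

Ltac regular :=
  repeat first
    [ assumption | apply: regular_const | apply: regular_id | apply: regular_div
    | apply: regular_inv | apply: regular_add | apply: regular_opp
    | apply: regular_exp | apply: regular_mul ].

Section Regular.
Variable F : numFieldType.
Implicit Types q z a c x y : F -> F.

Lemma regular_bulk t0 q z b l t r :
  regular_at t0 q -> regular_at t0 z -> 1 - q t0 * z t0 != 0 ->
  regular_at t0 (fun u => bulk_weight (q u) (z u) b l t r).
Proof. by move=> qr zr qz; case: b; case: l; case: t; case: r; rewrite /=; regular. Qed.

Lemma regular_hfun t0 a c x :
  regular_at t0 a -> regular_at t0 c -> regular_at t0 x ->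
  a t0 - x t0 != 0 -> c t0 - x t0 != 0 ->
  regular_at t0 (fun u => hfun (a u) (c u) (x u)).
Proof. by move=> ar cr xr ax cx; rewrite /hfun; regular; rewrite mulf_neq0. Qed.

Lemma regular_boundary t0 a c x b l :
  regular_at t0 a -> regular_at t0 c -> regular_at t0 x ->
  a t0 != 0 -> c t0 != 0 -> a t0 - x t0 != 0 -> c t0 - x t0 != 0 ->
  regular_at t0 (fun u => boundary_weight (a u) (c u) (x u) b l).
Proof.
move=> ar cr xr a0 c0 ax cx; have hr := regular_hfun ar cr xr ax cx.
by case: b; case: l; rewrite /=; regular; rewrite mulf_neq0.
Qed.

Lemma regular_Qfun t0 q a c x y :
  regular_at t0 q -> regular_at t0 a -> regular_at t0 c ->
  regular_at t0 x -> regular_at t0 y -> a t0 != 0 -> c t0 != 0 ->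
  a t0 - x t0 != 0 -> c t0 - x t0 != 0 -> a t0 - y t0 != 0 -> c t0 - y t0 != 0 ->
  1 - q t0 * (x t0 * y t0) != 0 ->
  regular_at t0 (fun u => Qfun (q u) (a u) (c u) (x u) (y u)).
Proof.
move=> qr ar cr xr yr a0 c0 ax cx ay cy qxy.
have hx := regular_hfun ar cr xr ax cx; have hy := regular_hfun ar cr yr ay cy.
by rewrite /Qfun; regular; rewrite ?mulf_neq0 // -mulrA.
Qed.

End Regular.

Section LatticeRegular.
Variables (F : numFieldType) (q a c : F).

Lemma regular_row_weight t0 l s v k :
  {in s, forall y, 1 - q * (t0 * y) != 0} ->
  regular_at t0 (fun X => row_weight q X l s v k).
Proof.
elim: s l v k => [|y s IH] l [|b v] k ys /=; try exact: regular_const.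
apply: regular_sum => r _; apply: regular_sum => t _; apply: regular_mul.
  by apply: regular_bulk; [regular | regular | apply: ys; rewrite mem_head].
by apply: IH => y' y's; apply: ys; rewrite inE y's orbT.
Qed.

Lemma regular_Zlat t0 s : a != 0 -> c != 0 -> a - t0 != 0 -> c - t0 != 0 ->
  {in s, forall y, 1 - q * (t0 * y) != 0} ->
  regular_at t0 (fun X => Zlat q a c (X :: s)).
Proof.
move=> a0 c0 at0 ct0 ys; rewrite /Zlat /=; apply: regular_sum => l _.
apply: regular_mul; last exact: regular_row_weight.
by apply: (@regular_boundary _ t0 (fun=> a) (fun=> c) id false l); regular.
Qed.

Lemma generic_lin (u v : F) : (u != 0) || (v != 0) -> generic (fun X => u + v * X != 0).
Proof.
move=> uv; have: u%:P + v *: 'X != 0.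
  apply: contraTneq uv => uv0; have := congr1 (horner^~ 0) uv0.
  have := congr1 (horner^~ 1) uv0; rewrite /= !hornerE => uv1 u0.
  by move: uv1; rewrite u0 add0r => ->; rewrite eqxx.
by move/generic_poly; apply: generic_sub => t; rewrite !hornerE.
Qed.

Lemma poly_generic_bulk (y : F) b l t r :
  poly_generic 1 (fun X => (1 - q * (X * y)) * bulk_weight q (X * y) b l t r).
Proof.
have den : generic (fun X => 1 - q * (X * y) != 0).
  apply: generic_sub (generic_lin (u := 1) (v := - (q * y)) _); last by rewrite oner_eq0.
  by move=> X; congr (_ != 0); ring.
have lin u v f : (forall X, 1 - q * (X * y) != 0 -> f X = u + v * X) -> poly_generic 1 f.
  move=> fE; apply: poly_generic_eq (poly_generic_lin u v).
  by apply: generic_sub den => X /fE ->.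
case: b; case: l; case: t; case: r; rewrite /=.
(* Goals 1 and 16 are the all-1 and all-0 crossings, whose weight 1 becomes the cleared denominator
   itself. *)
1,16: by apply: (lin 1 (- (q * y))) => X _; ring.
all: try by apply: (lin 0 0) => X _; ring.
- by apply: (lin q (- (q * y))) => X dX; field.
- by apply: (lin (1 - q) 0) => X dX; field.
- by apply: (lin 0 (y * (1 - q))) => X dX; field.
- by apply: (lin 1 (- y)) => X dX; field.
Qed.

Lemma poly_generic_row_weight l s v k :
  poly_generic (size s) (fun X => (\prod_(y <- s) (1 - q * (X * y))) * row_weight q X l s v k).
Proof.
have zero d f : (forall X, f X = 0) -> poly_generic d f.
  move=> f0; apply: poly_generic_eq (poly_generic_le (leq0n d) (poly_generic_const 0)).
  exact: generic_all.
elim: s l v k => [|y s IH] l [|b v] k /=; try by apply: zero => X; rewrite mulr0.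
  apply: poly_generic_eq (poly_generic_const (if l then 0 else k [::])).
  by apply: generic_all => X; rewrite big_nil mul1r.
apply: (poly_generic_eq (f := fun X => \sum_(r : bool) \sum_(t : bool)
  ((1 - q * (X * y)) * bulk_weight q (X * y) b l t r) *
  ((\prod_(y <- s) (1 - q * (X * y))) * row_weight q X r s v (fun w => k (t :: w))))).
  apply: generic_all => X; rewrite big_cons big_distrr; apply: eq_bigr => r _.
  by rewrite big_distrr; apply: eq_bigr => t _; rewrite /= mulrACA.
apply: poly_generic_sum => r _; apply: poly_generic_sum => t _.
by rewrite -add1n; apply: poly_generic_mul; [exact: poly_generic_bulk | exact: IH].
Qed.

Lemma poly_generic_h : poly_generic 2 (fun X => (a - X) * (c - X) * hfun a c X).
Proof.
apply: (poly_generic_eq (f := fun X => (a * c + (a * c) * X) * (1 + (-1) * X))).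
  have acn : generic (fun X => a - X != 0 /\ c - X != 0).
    apply: generic_and; first apply: (generic_sub _ (generic_lin (u := a) (v := -1) _)).
    - by move=> X; rewrite mulN1r.
    - by rewrite oppr_eq0 oner_eq0 orbT.
    apply: (generic_sub _ (generic_lin (u := c) (v := -1) _)).
    - by move=> X; rewrite mulN1r.
    - by rewrite oppr_eq0 oner_eq0 orbT.
  apply: generic_sub acn => X [aX cX]; rewrite /hfun; field.
  by rewrite aX cX.
exact: (poly_generic_mul (poly_generic_lin _ _) (poly_generic_lin _ _)).
Qed.

Lemma poly_generic_one_sub_h :
  poly_generic 2 (fun X => (a - X) * (c - X) * (1 - hfun a c X)).
Proof.
apply: (poly_generic_eq (f := fun X => (a + (-1) * X) * (c + (-1) * X) +
   (-1) * ((a - X) * (c - X) * hfun a c X))).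
  by apply: generic_all => X; ring.
apply: poly_generic_add.
  exact: (poly_generic_mul (poly_generic_lin _ _) (poly_generic_lin _ _)).
exact: (poly_generic_mul (poly_generic_const _) poly_generic_h).
Qed.

(** As [X] belongs to the first line, it occurs only in one boundary vertex, of degree 2 after
    clearing, and in one crossing of degree 1 with each other line. *)
Lemma poly_generic_Zlat s : poly_generic (2 + size s) (fun X =>
  (a - X) * (c - X) * (\prod_(y <- s) (1 - q * (X * y))) * Zlat q a c (X :: s)).
Proof.
pose f l X := (a - X) * (c - X) * boundary_weight a c X false l *
  ((\prod_(y <- s) (1 - q * (X * y))) *
    row_weight q X l s (nseq (size s) false) (lattice q a c s)).
apply: (poly_generic_eq (f := fun X => \sum_l f l X)).
  apply: generic_all => X; rewrite /Zlat /= big_distrr; apply: eq_bigr => l _.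
  by rewrite /f /=; ring.
apply: poly_generic_sum => l _; apply: poly_generic_mul; last exact: poly_generic_row_weight.
by case: l; [exact: poly_generic_h | exact: poly_generic_one_sub_h].
Qed.

End LatticeRegular.

(** * Interpolation *)

Section Interpolation.
Variables (F : numFieldType) (q a c : F).
Local Notation h := (hfun a c).
Local Notation Zlat := (Zlat q a c).

(* [None] stands for the point 1, where the generic entry would be 0 / 0. *)
Definition pairing (p r : option F) : F :=
  match p, r with
  | Some x, Some y => (x - y) / (1 - x * y) * Qfun q a c x y
  | None, Some y => 1 - h y
  | Some x, None => - (1 - h x)
  | None, None => 0
  end.

Lemma QfunC x y : Qfun q a c x y = Qfun q a c y x.
Proof.
rewrite /Qfun; congr (_ - _); first exact: mulrC.
by rewrite (mulrC (h x)) -!(mulrA q) -!(mulrA (1 - q)) (mulrC x).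
Qed.

Lemma pairing_skew p r : pairing p r = - pairing r p.
Proof.
case: p r => [x|] [y|] /=; rewrite ?opprK ?oppr0 //.
by rewrite QfunC (mulrC x y) -!mulNr opprB.
Qed.

Local Notation Pf := (Pf None pairing).

Definition pair_weight (x y : F) := (1 - x * y) / (x - y).

Fixpoint weight_prod (s : seq F) : F :=
  if s is x :: s' then (\prod_(y <- s') pair_weight x y) * weight_prod s' else 1.

Definition points (s : seq F) : seq (option F) :=
  nseq (odd (size s)) None ++ map Some s.

Definition Zpf (s : seq F) : F := weight_prod s * Pf (points s).

Lemma pair_weightC x y : pair_weight x y = - pair_weight y x.
Proof. by rewrite /pair_weight -(opprB y x) invrN mulrN (mulrC x). Qed.

Lemma weight_prod_swap s1 x y s2 :
  weight_prod (s1 ++ x :: y :: s2) = - weight_prod (s1 ++ y :: x :: s2).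
Proof.
elim: s1 => [|w s1 IH] /=; last first.
  rewrite IH mulrN; congr (- (_ * _)); apply: perm_big.
  by rewrite perm_cat2l -(cat1s x) -(cat1s y (x :: _)) -(cat1s x s2) -(cat1s y s2) perm_catCA.
by rewrite !big_cons (pair_weightC x y); ring.
Qed.

(** Both the product of pair weights and the Pfaffian change sign. *)
Lemma Zpf_swap s1 x y s2 : Zpf (s1 ++ x :: y :: s2) = Zpf (s1 ++ y :: x :: s2).
Proof.
rewrite /Zpf weight_prod_swap /points !map_cat /= !size_cat /= !catA.
by rewrite Pf_swap mulrNN.
Qed.

Lemma Zpf_nil : Zpf [::] = 1.
Proof. by rewrite /Zpf /points /= Pf_nil mulr1. Qed.

Definition tail_points (s : seq F) : seq (option F) :=
  nseq (~~ odd (size s)) None ++ map Some s.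

Lemma odd_tail_points s : odd (size (tail_points s)).
Proof. by rewrite size_cat size_nseq size_map oddD oddb; case: (odd _). Qed.

(** The sign arises when [s] has even size: then [None] heads the list and is exchanged with
    [Some x]. *)
Lemma Zpf_cons x s : Zpf (x :: s) =
  (\prod_(y <- s) pair_weight x y) * ((-1) ^+ (~~ odd (size s)) * weight_prod s) *
  Pf (Some x :: tail_points s).
Proof.
rewrite /Zpf /points /tail_points /=; case: (odd _) => /=.
  by rewrite expr0 mul1r.
by rewrite -[_ :: _ :: _]/([::] ++ _) Pf_swap /= expr1; ring.
Qed.

Lemma mem_tail_points s p : p \in tail_points s -> p = None \/ exists2 y, y \in s & p = Some y.
Proof.
rewrite mem_cat mem_nseq => /orP[/andP[_ /eqP]|/mapP[y ys ->]]; first by left.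
by right; exists y.
Qed.

Lemma regular_pairing t0 p (s : seq F) : a != 0 -> c != 0 -> a - t0 != 0 -> c - t0 != 0 ->
  {in s, forall y, [/\ a - y != 0, c - y != 0, 1 - t0 * y != 0 & 1 - q * (t0 * y) != 0]} ->
  p = None \/ (exists2 y, y \in s & p = Some y) ->
  regular_at t0 (fun X => pairing (Some X) p).
Proof.
move=> a0 c0 at0 ct0 sP [->|[y /sP[ay cy ty qty] ->]] /=.
  have hr : regular_at t0 (fun X => h X).
    by apply: (@regular_hfun _ t0 (fun=> a) (fun=> c) id); regular.
  by regular.
apply: regular_mul; first by regular.
by apply: (@regular_Qfun _ t0 (fun=> q) (fun=> a) (fun=> c) id (fun=> y)); regular.
Qed.

Lemma regular_Pf t0 (t : seq (option F)) : odd (size t) ->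
  {in t, forall p, regular_at t0 (fun X => pairing (Some X) p)} ->
  regular_at t0 (fun X => Pf (Some X :: t)).
Proof.
move=> ot tP; apply: (eq_regular (f := fun X => \sum_(j < size t)
    (-1) ^+ j * pairing (Some X) (nth None t j) * Pf (delete j t))) => [X|].
  by rewrite Pf_expand //; exact: pairing_skew.
by apply: regular_sum => j _; have kr := tP _ (mem_nth None (ltn_ord j)); regular.
Qed.

Lemma regular_pair_weights t0 (s : seq F) : {in s, forall y, t0 - y != 0} ->
  regular_at t0 (fun X => \prod_(y <- s) pair_weight X y).
Proof.
move=> sP; apply: (eq_regular (f := fun X => \prod_(y <- s | y \in s) pair_weight X y)).
  by move=> X; rewrite -big_seq.
by apply: regular_prod => y /sP ty; rewrite /pair_weight; regular.
Qed.

Lemma regular_Zpf t0 s : a != 0 -> c != 0 -> a - t0 != 0 -> c - t0 != 0 ->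
  {in s, forall y, [/\ a - y != 0, c - y != 0, 1 - t0 * y != 0 & 1 - q * (t0 * y) != 0]} ->
  {in s, forall y, t0 - y != 0} ->
  regular_at t0 (fun X => Zpf (X :: s)).
Proof.
move=> a0 c0 at0 ct0 sP ts.
apply: eq_regular; first by move=> X; rewrite Zpf_cons.
apply: regular_mul; first by apply: regular_mul; [exact: regular_pair_weights|regular].
apply: regular_Pf; first exact: odd_tail_points.
by move=> p /mem_tail_points; apply: regular_pairing.
Qed.

(** Since h(0) = 1, every entry of the first row vanishes, the one against [None] included. *)
Lemma Zpf0 s : a != 0 -> c != 0 -> Zpf (0 :: s) = 0.
Proof.
move=> a0 c0; rewrite Zpf_cons (Pf_expand None pairing_skew) ?odd_tail_points //.
rewrite [X in _ * X]big1 ?mulr0 //.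
move=> j _; have h0 : h 0 = 1 by rewrite /hfun; field; rewrite a0 c0.
have := mem_tail_points (mem_nth None (ltn_ord j)).
by move=> [->|[y _ ->]] /=; rewrite /Qfun ?h0; ring.
Qed.

Lemma pair_weight_sqr1 x y : x ^+ 2 = 1 -> x - y != 0 -> pair_weight x y = x.
Proof.
move=> x1 xy; apply: (mulIf xy); rewrite /pair_weight divfK //.
by rewrite mulrBr -expr2 x1.
Qed.

Lemma hfun_sqr1 x : x ^+ 2 = 1 -> h x = 0.
Proof. by move=> x1; rewrite /hfun x1 subrr mulr0 mul0r. Qed.

Lemma pairing_sqr1 x y : x ^+ 2 = 1 -> x - y != 0 -> pairing (Some x) (Some y) = x * (1 - h y).
Proof.
move=> x1 xy; rewrite /= /Qfun (hfun_sqr1 x1).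
have -> : 1 - x * y = x * (x - y) by rewrite mulrBr -expr2 x1.
have x0 : x != 0 by apply: contra_eq_neq x1 => ->; rewrite expr0n eq_sym oner_eq0.
rewrite invfM mulrCA divff // mulr1 (_ : x^-1 = x); first by ring.
by apply: (mulfI x0); rewrite divff // -expr2.
Qed.

(** Row [Some x] is [x] times row [None]. In odd size of [s] it therefore turns into the border of
    [s], and the two factors [x] cancel; in even size the two rows are twins whose mutual entry is 1
    - h(x) = 1, and both disappear by [Pf_twin]. *)
Lemma Zpf_sqr1 x s : x ^+ 2 = 1 -> {in s, forall y, x - y != 0} -> Zpf (x :: s) = Zpf s.
Proof.
move=> x1 xs; have wE : \prod_(y <- s) pair_weight x y = x ^+ size s.
  rewrite big_seq (eq_bigr (fun=> x)) => [|y /xs]; last exact: pair_weight_sqr1.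
  by rewrite -big_seq big_const_seq count_predT iter_mulr_1.
have kE : {in map Some s, forall p, pairing None p = x * pairing (Some x) p}.
  move=> _ /mapP[y ys ->]; rewrite pairing_sqr1 ?xs // mulrA -expr2 x1; exact/esym/mul1r.
have kE' : {in map Some s, forall p, pairing (Some x) p = x * pairing None p}.
  by move=> _ /mapP[y ys ->]; rewrite pairing_sqr1 ?xs.
have xn : x ^+ size s = if odd (size s) then x else 1.
  by rewrite -[in LHS](odd_double_half (size s)) exprD -mul2n exprM x1 expr1n mulr1; case: (odd _).
rewrite /Zpf /= wE xn /points /=; case: ifP => os /=; last first.
  rewrite (Pf_twin None pairing_skew (k := x)) ?size_map ?os // mul1r.
  by rewrite /= (hfun_sqr1 x1) subr0 mul1r.
have -> : Pf (Some x :: map Some s) = x * Pf (None :: map Some s).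
  rewrite !(Pf_expand None pairing_skew) ?size_map // mulr_sumr.
  by apply: eq_bigr => j _; rewrite kE' ?mem_nth ?size_map // !mulrA (mulrC x).
by transitivity (x ^+ 2 * (weight_prod s * Pf (None :: map Some s))); [ring | rewrite x1 mul1r].
Qed.

(** * Degree of the cleared difference *)

Hypotheses (a0 : a != 0) (c0 : c != 0).

Lemma poly_generic_prod (s : seq F) (u v : F -> F) :
  poly_generic (size s) (fun X => \prod_(y <- s) (u y + v y * X)).
Proof.
elim: s => [|y s IH].
  by apply: poly_generic_eq (poly_generic_const 1); apply: generic_all => X; rewrite big_nil.
rewrite /= -add1n; apply: poly_generic_eq (poly_generic_mul (poly_generic_lin (u y) (v y)) IH).
by apply: generic_all => X; rewrite big_cons.
Qed.

Lemma generic_linE (u v : F) (f : F -> F) : (forall X, f X = u + v * X) ->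
  (u != 0) || (v != 0) -> generic (fun X => f X != 0).
Proof.
move=> fE uv; apply: generic_sub (generic_lin uv) => X; by rewrite fE.
Qed.

Lemma generic_subl (u : F) : generic (fun X => u - X != 0).
Proof.
apply: (generic_linE (u := u) (v := -1)); first by move=> X; rewrite mulN1r.
by rewrite oppr_eq0 oner_eq0 orbT.
Qed.

Lemma generic_subr (u : F) : generic (fun X => X - u != 0).
Proof. by apply: generic_sub (generic_subl u) => X; rewrite -opprB oppr_eq0. Qed.

Lemma generic_1sub (u : F) : generic (fun X => 1 - u * X != 0).
Proof.
apply: (generic_linE (u := 1) (v := - u)); first by move=> X; rewrite mulNr.
by rewrite oner_eq0.
Qed.

Lemma poly_generic_pairing s p : p \in tail_points s ->
  poly_generic (2 + size s + size s) (fun X =>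
    (a - X) * (c - X) * (\prod_(y <- s) (1 - q * (X * y))) *
    (\prod_(y <- s) (1 - X * y)) * pairing (Some X) p).
Proof.
have prodq s' : poly_generic (size s') (fun X : F => \prod_(y <- s') (1 - q * (X * y))).
  apply: poly_generic_eq (poly_generic_prod s' (fun=> 1) (fun y => - (q * y))).
  by apply: generic_all => X; apply: eq_bigr => y _; ring.
have prod1 s' : poly_generic (size s') (fun X : F => \prod_(y <- s') (1 - X * y)).
  apply: poly_generic_eq (poly_generic_prod s' (fun=> 1) (fun y => - y)).
  by apply: generic_all => X; apply: eq_bigr => y _; ring.
move=> /mem_tail_points [->|[y ys ->]] /=.
  apply: (poly_generic_eq (f := fun X =>
    ((-1) * ((a - X) * (c - X) * (1 - h X))) *
    (\prod_(y <- s) (1 - q * (X * y))) * (\prod_(y <- s) (1 - X * y)))).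
    by apply: generic_all => X; ring.
  apply: poly_generic_mul (prod1 s); apply: poly_generic_mul (prodq s).
  exact: (poly_generic_mul (poly_generic_const _) (poly_generic_one_sub_h a c)).
have sz : size s = (size (rem y s)).+1 by rewrite size_rem // prednK //; case: (s) ys.
rewrite sz; set r := rem y s.
(* The factors of [y] in both products cancel the poles of this entry. What remains has degree 1
   from [X - y], 2 from the boundary, 1 from the numerator over [1 - q * (X * y)], and 2 for each
   other line. *)
have -> : (2 + (size r).+1 + (size r).+1 = (1 + (2 + 1)) + (size r + size r))%N.
  by rewrite !addnS !addSn.
apply: (poly_generic_eq (f := fun X =>
  ((- y + 1 * X) * ((a - X) * (c - X) * (1 - h X) * ((1 - h y) + (- (1 - h y) * (q * y)) * X) +
     (a - X) * (c - X) * h X * (0 + (- (h y / (a * c) * (1 - q) * y)) * X))) *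
  ((\prod_(y <- r) (1 - q * (X * y))) * (\prod_(y <- r) (1 - X * y))))).
  apply: generic_sub (generic_and (generic_1sub y) (generic_1sub (q * y))) => X [Xy qXy].
  rewrite !(big_rem y ys) /= -/r /Qfun; move: (h X) (h y) => hX hy.
  rewrite mulrC in Xy; rewrite (_ : q * y * X = q * (X * y)) in qXy; last by ring.
  by field; rewrite c0 a0 Xy -mulrA qXy.
apply: poly_generic_mul; last exact: poly_generic_mul.
apply: poly_generic_mul; first exact: poly_generic_lin.
apply: poly_generic_add; apply: poly_generic_mul; try exact: poly_generic_lin.
  exact: poly_generic_one_sub_h.
exact: poly_generic_h.
Qed.

Lemma generic_subs (s : seq F) : @generic F (fun X => {in s, forall y, X - y != 0}).
Proof. by apply: (@generic_in F _ s (fun y X => X - y != 0)) => y _; exact: generic_subr. Qed.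

Lemma prod_pair_weight (X : F) (s : seq F) : {in s, forall y, X - y != 0} ->
  (\prod_(y <- s) (X - y)) * (\prod_(y <- s) pair_weight X y) = \prod_(y <- s) (1 - X * y).
Proof.
move=> Xs; rewrite -big_split big_seq [RHS]big_seq; apply: eq_bigr => y /Xs Xy.
by rewrite /pair_weight /= mulrCA divff ?mulr1.
Qed.

(** Factors [1 - X * y] are absent because the pair weights already supply them against the poles of
    the entries. *)
Definition den (s : seq F) X :=
  (a - X) * (c - X) * (\prod_(y <- s) (1 - q * (X * y))) * (\prod_(y <- s) (X - y)).

(** The product [den s X * Zpf (X :: s)] with each [X - y] cancelled, so that it has its true value
    at [X = y]. *)
Definition cleared (s : seq F) X :=
  (a - X) * (c - X) * (\prod_(y <- s) (1 - q * (X * y))) * (\prod_(y <- s) (1 - X * y)) *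
  ((-1) ^+ (~~ odd (size s)) * weight_prod s) * Pf (Some X :: tail_points s).

Lemma cleared_Zpf s X : {in s, forall y, X - y != 0} -> den s X * Zpf (X :: s) = cleared s X.
Proof. by move=> Xs; rewrite Zpf_cons /cleared -prod_pair_weight // /den; ring. Qed.

Lemma poly_generic_Zpf s :
  poly_generic (2 + size s + size s) (fun X => den s X * Zpf (X :: s)).
Proof.
apply: (poly_generic_eq (f := cleared s)).
  by apply: generic_sub (generic_subs s) => X Xs; rewrite cleared_Zpf.
apply: (poly_generic_eq (f := fun X => \sum_(j < size (tail_points s))
  ((-1) ^+ (~~ odd (size s)) * weight_prod s * (-1) ^+ j * Pf (delete j (tail_points s))) *
  ((a - X) * (c - X) * (\prod_(y <- s) (1 - q * (X * y))) *
    (\prod_(y <- s) (1 - X * y)) * pairing (Some X) (nth None (tail_points s) j)))).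
  apply: generic_all => X; rewrite /cleared (Pf_expand None (pairing_skew)) ?odd_tail_points //.
  by rewrite big_distrr; apply: eq_bigr => j _ /=; move: (pairing (Some X)) => k; ring.
apply: poly_generic_sum => j _; rewrite -[X in poly_generic X]add0n.
apply: poly_generic_mul; first exact: poly_generic_const.
by apply: poly_generic_pairing; rewrite mem_nth.
Qed.

Lemma poly_generic_delta s :
  poly_generic (2 + size s + size s) (fun X => den s X * (Zlat (X :: s) - Zpf (X :: s))).
Proof.
apply: (poly_generic_eq (f := fun X =>
  ((a - X) * (c - X) * (\prod_(y <- s) (1 - q * (X * y))) * Zlat (X :: s)) *
    (\prod_(y <- s) (- y + 1 * X)) + (-1) * (den s X * Zpf (X :: s)))).
  apply: generic_all => X.
  have -> : \prod_(y <- s) (- y + 1 * X) = \prod_(y <- s) (X - y).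
    by apply: eq_bigr => y _; ring.
  by rewrite /den; ring.
apply: poly_generic_add.
  by apply: poly_generic_mul; [exact: poly_generic_Zlat | exact: poly_generic_prod].
rewrite -[X in poly_generic X]add0n.
by apply: poly_generic_mul; [exact: poly_generic_const | exact: poly_generic_Zpf].
Qed.

(** Besides the poles of the weights, this excludes poles of h at [x^-1] ([a * x - 1], [c * x - 1]),
    poles of the crossings at the nodes 1 and -1 ([good_q]), and poles of the Yang-Baxter crossing
    ([x - q * y]). In [good2] the case [x = y] counts: [1 - x * x != 0] keeps the nodes x and 1/x
    apart and off 1 and -1. *)
Record good (s : seq F) : Prop := Good {
  good_uniq : uniq s;
  good1 : {in s, forall x, [/\ x != 0, a - x != 0, c - x != 0, a * x - 1 != 0 & c * x - 1 != 0]};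
  good_q : {in s, forall x, 1 - q * x != 0 /\ 1 + q * x != 0};
  good2 : {in s &, forall x y, [/\ 1 - x * y != 0, 1 - q * (x * y) != 0 & x - q * y != 0]} }.

Lemma good_sub s s' : uniq s' -> {subset s' <= s} -> good s -> good s'.
Proof.
move=> us' ss' [us g1 gq g2]; split=> //; first by move=> x /ss'/g1.
  by move=> x /ss'/gq.
by move=> x y /ss' xs /ss' ys; apply: g2.
Qed.

Lemma good_perm s s' : perm_eq s s' -> good s -> good s'.
Proof.
move=> pss' gs; apply: (good_sub _ _ gs); last by move=> x; rewrite (perm_mem pss').
by rewrite -(perm_uniq pss') (good_uniq gs).
Qed.

Lemma generic_horner (p : {poly F}) x0 (f : F -> F) :
  p.[x0] != 0 -> (forall X, f X = p.[X]) -> generic (fun X => f X != 0).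
Proof.
move=> px0 fE; have : p != 0 by apply: contraNneq px0 => ->; rewrite horner0.
by move/generic_poly; apply: generic_sub => X; rewrite fE.
Qed.

Hypothesis q1 : 1 - q != 0.

Lemma generic_good s : good s -> @generic F (fun X => good (X :: s)).
Proof.
move=> gs.
have e1 : @generic F (fun X => X != 0).
  by apply: generic_sub (generic_subr 0) => X; rewrite subr0.
have e2 := generic_subl a; have e3 := generic_subl c.
have lin1 (u : F) : @generic F (fun X => u * X - 1 != 0).
  by apply: generic_sub (generic_1sub u) => X; rewrite -opprB oppr_eq0.
have e4 := lin1 a; have e5 := lin1 c.
have e6 := generic_1sub q.
have e7 : @generic F (fun X => 1 + q * X != 0).
  by apply: generic_sub (generic_1sub (- q)) => X; rewrite mulNr opprK.
have e8 : @generic F (fun X => 1 - X * X != 0).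
  apply: (generic_horner (p := 1 - 'X * 'X) (x0 := 0)) => [|X]; rewrite !hornerE //.
  by rewrite ?(mulr0, mul0r, oppr0, addr0, subr0) oner_eq0.
have e9 : @generic F (fun X => 1 - q * (X * X) != 0).
  apply: (generic_horner (p := 1 - q *: ('X * 'X)) (x0 := 0)) => [|X]; rewrite !hornerE //.
  by rewrite /= mulr0 subr0 oner_eq0.
have e10 : {in s, forall y, @generic F (fun X =>
    [/\ X - y != 0, 1 - X * y != 0, 1 - q * (X * y) != 0,
     X - q * y != 0 & y - q * X != 0])}.
  move=> y ys; have [y0 _ _ _ _] := good1 gs ys.
  have f1 := generic_subr y; have f2 := generic_1sub y.
  have f3 := generic_1sub (q * y); have f4 := generic_subr (q * y).
  have f5 : @generic F (fun X => y - q * X != 0).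
    by apply: (generic_linE (u := y) (v := - q)) => [X|]; rewrite ?mulNr // y0.
  apply: generic_sub (generic_and f1 (generic_and f2 (generic_and f3 (generic_and f4 f5)))).
  move=> X [g1 [g2 [g3 [g4 g5]]]]; split=> //; first by rewrite mulrC.
  by rewrite (_ : q * (X * y) = q * y * X) //; ring.
have := generic_and e1 (generic_and e2 (generic_and e3 (generic_and e4 (generic_and e5
  (generic_and e6 (generic_and e7 (generic_and e8 (generic_and e9 (generic_in e10))))))))).
apply: generic_sub => X [x1 [x2 [x3 [x4 [x5 [x6 [x7 [x8 [x9 x10]]]]]]]]].
split.
- rewrite /= (good_uniq gs) andbT; apply: contraT; rewrite negbK => /x10 [].
  by rewrite subrr eqxx.
- by move=> x; rewrite inE => /predU1P[-> | /(good1 gs)].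
- by move=> x; rewrite inE => /predU1P[-> | /(good_q gs)].
move=> x y; rewrite !inE => /predU1P[-> | xs] /predU1P[-> | ys].
(* On the diagonal, X - q X = (1 - q) X is nonzero by [q1]. *)
- by split=> //; rewrite -[X in X - _]mul1r -mulrBl mulf_neq0.
- by have [] := x10 _ ys.
- by have [_ ? ? _ ?] := x10 _ xs; rewrite !(mulrC x).
- exact: (good2 gs).
Qed.

Lemma Zlat_move s0 s1 y s2 : good (s0 ++ s1 ++ y :: s2) ->
  Zlat (s0 ++ s1 ++ y :: s2) = Zlat (s0 ++ y :: s1 ++ s2).
Proof.
elim: s1 s0 => [|w s1 IH] s0 //= gs.
have gs' : good (s0 ++ w :: y :: s1 ++ s2).
  by apply: good_perm gs; rewrite perm_cat2l perm_cons -cat1s perm_catCA.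
transitivity (Zlat (s0 ++ w :: y :: s1 ++ s2)).
  by rewrite -cat_rcons IH ?cat_rcons.
have [mw my] : w \in s0 ++ w :: y :: s1 ++ s2 /\ y \in s0 ++ w :: y :: s1 ++ s2.
  by rewrite !mem_cat !inE !eqxx !orbT.
have [w0 aw cw _ _] := good1 gs' mw; have [_ ay cy _ _] := good1 gs' my.
have [_ qwy wqy] := good2 gs' mw my.
apply: Zlat_swap => // u; rewrite mem_cat => us.
have mu : u \in s0 ++ w :: y :: s1 ++ s2.
  by rewrite mem_cat !inE; case/orP: us => ->; rewrite ?orbT.
by have [_ ? _] := good2 gs' mw mu; have [_ ? _] := good2 gs' my mu.
Qed.

Lemma Zpf_move s0 s1 y s2 : Zpf (s0 ++ s1 ++ y :: s2) = Zpf (s0 ++ y :: s1 ++ s2).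
Proof.
elim: s1 s0 => [|w s1 IH] s0 //=.
by rewrite -cat_rcons IH cat_rcons Zpf_swap.
Qed.

Lemma den_neq0 X s : good (X :: s) -> den s X != 0.
Proof.
move=> gs; have mX := mem_head X s; have [_ aX cX _ _] := good1 gs mX.
have ms y : y \in s -> y \in X :: s by move=> ys; rewrite inE ys orbT.
rewrite /den !mulf_neq0 // prodf_seq_neq0; apply/allP => y ys /=.
  by have [_ ? _] := good2 gs mX (ms y ys).
rewrite subr_eq0; apply: contraTneq ys => <-.
by have /andP[] := good_uniq gs.
Qed.

(** * Values at the interpolation nodes *)

Lemma regular_den t0 s : regular_at t0 (den s).
Proof.
by rewrite /den; regular; apply: regular_prod => y _; regular.
Qed.

Lemma good_tail X s : good (X :: s) -> good s.
Proof.
move=> gs; apply: (good_sub _ _ gs); first by have /andP[] := good_uniq gs.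
by move=> y ys; rewrite inE ys orbT.
Qed.

Lemma generic_delta_at_sqr1 x s : good s -> x ^+ 2 = 1 -> a - x != 0 -> c - x != 0 ->
  Zlat s = Zpf s ->
  regular_at x (fun X => den s X * (Zlat (X :: s) - Zpf (X :: s))) /\
  Zlat (x :: s) = Zpf (x :: s).
Proof.
move=> gs x1 ax cx ZG.
have x0 : x != 0 by apply: contra_eq_neq x1 => ->; rewrite expr0n eq_sym oner_eq0.
have xs : {in s, forall y, 1 - x * y != 0 /\ x - y != 0}.
  move=> y ys; have [yy _ _] := good2 gs ys ys.
  have xy : x - y != 0.
    by apply: contraNneq yy => /subr0_eq <-; rewrite -expr2 x1 subrr.
  split=> //; rewrite (_ : 1 - x * y = x * (x - y)) ?mulf_neq0 //.
  by rewrite mulrBr -expr2 x1.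
have xq : {in s, forall y, 1 - q * (x * y) != 0}.
  move=> y ys; have [qm qp] := good_q gs ys.
  have /eqP := x1; rewrite sqrf_eq1 => /orP[]/eqP->.
    by rewrite mul1r.
  by rewrite mulN1r mulrN opprK.
split; last by rewrite Zlat_sqr1 // Zpf_sqr1 // => y /xs[].
apply: regular_mul; first exact: regular_den.
apply: regular_sub; first exact: regular_Zlat.
apply: regular_Zpf => // y ys; last by have [] := xs y ys.
by have [_ ? ? _ _] := good1 gs ys; split=> //; [have [] := xs y ys | exact: xq].
Qed.

Lemma regular_delta_at_0 s : good s ->
  regular_at 0 (fun X => den s X * (Zlat (X :: s) - Zpf (X :: s))).
Proof.
move=> gs; apply: regular_mul; first exact: regular_den.
apply: regular_sub.
  by apply: regular_Zlat; rewrite ?subr0 // => y _; rewrite mul0r mulr0 subr0 oner_eq0.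
apply: regular_Zpf; rewrite ?subr0 // => y ys; have [y0 ay cy _ _] := good1 gs ys.
  by rewrite !(mul0r, mulr0) subr0 oner_eq0.
by rewrite sub0r oppr_eq0.
Qed.

Lemma Pf_repeat_mem p t : p \in t -> Pf (p :: t) = 0.
Proof. by case/splitPr => t1 t2; exact: (Pf_repeat None pairing [::] p t1 t2). Qed.

(** [Zpf] divides by 0 at [X = y], so [f] uses [cleared] instead. It vanishes there since [den] does
    and the label [Some y] occurs twice in the Pfaffian. *)
Lemma delta_at_node y s : good s -> y \in s ->
  exists f, [/\ regular_at y f, f y = 0 &
    @generic F (fun X => f X = den s X * (Zlat (X :: s) - Zpf (X :: s)))].
Proof.
move=> gs ys; exists (fun X => den s X * Zlat (X :: s) - cleared s X).
have [_ ay cy _ _] := good1 gs ys.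
split.
- apply: regular_sub.
    apply: regular_mul; first exact: regular_den.
    by apply: regular_Zlat => // y' y's; have [] := good2 gs ys y's.
  apply: regular_mul; first by regular; apply: regular_prod => y' _; regular.
  apply: regular_Pf; first exact: odd_tail_points.
  move=> p /mem_tail_points; apply: regular_pairing => // y' y's.
  have [_ ay' cy' _ _] := good1 gs y's.
  by have [? ? _] := good2 gs ys y's.
- have den0 : \prod_(y' <- s) (y - y') = 0.
    by apply/eqP; rewrite prodf_seq_eq0; apply/hasP; exists y; rewrite ?subrr /=.
  by rewrite /den /cleared den0 Pf_repeat_mem ?mem_cat ?map_f ?orbT // !mulr0 mul0r subr0.
- by apply: generic_sub (generic_subs s) => X Xs; rewrite mulrBr cleared_Zpf.
Qed.

(** At x y = 1 the fraction with q in Q equals 1, and Q(1/y, y) becomes the (0;0) entry of K_(1/y)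
    K_y = 1. *)
Lemma Qfun_inv y : y != 0 -> a - y != 0 -> c - y != 0 -> a * y - 1 != 0 ->
  c * y - 1 != 0 -> Qfun q a c y^-1 y = 1.
Proof.
move=> y0 ay cy ay1 cy1; rewrite /Qfun /hfun; field.
by rewrite y0 q1 c0 a0 cy ay cy1 ay1.
Qed.

(* A form of [Zpf (X :: y :: s)] that is still defined when [X * y = 1]. *)
Definition two_term_form y s X :=
  (\prod_(y' <- s) pair_weight X y') * (\prod_(y' <- s) pair_weight y y') * weight_prod s *
  (Qfun q a c X y * Pf (points s) - pair_weight X y *
   \sum_(j < size (points s)) (-1) ^+ j * pairing (Some X) (nth None (points s) j) *
     Pf (Some y :: delete j (points s))).

Lemma even_points (s : seq F) : ~~ odd (size (points s)).
Proof. by rewrite size_cat size_nseq size_map oddD oddb addbb. Qed.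

(** In the expansion along row [X], the weight of the pair (X, y) cancels the singular factor of the
    entry at [y]. A leading [None] moves past two labels, hence without a sign. *)
Lemma Zpf_cons2 X y s : X - y != 0 -> 1 - X * y != 0 -> Zpf (X :: y :: s) = two_term_form y s X.
Proof.
move=> Xy Xy1; have PfE : Pf (points (X :: y :: s)) = Pf (Some X :: Some y :: points s).
  rewrite /points /= negbK; case: (odd _) => //=.
  rewrite -[_ :: _ :: _]/([::] ++ _) Pf_swap /=.
  by rewrite -[_ :: _ :: _ :: _]/([:: Some X] ++ _) Pf_swap opprK.
have ep := even_points s.
rewrite /Zpf PfE (Pf_expand None (pairing_skew)) //= big_ord_recl /= big_cons.
rewrite [X in _ + X](_ : _ = - \sum_(j < size (points s)) (-1) ^+ j *
  pairing (Some X) (nth None (points s) j) * Pf (Some y :: delete j (points s))); last first.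
  rewrite -sumrN; apply: eq_bigr => j _; rewrite /delete /= /bump /= add0n add1n exprS.
  by rewrite mulN1r !mulNr.
rewrite /delete /= drop0 /two_term_form; move: (\sum_(_ < _) _) (\prod_(_ <- _) _)  => S W.
rewrite /pair_weight; field.
by rewrite ?Xy ?Xy1.
Qed.

Lemma pair_weight_inv (y y' : F) : y != 0 -> y - y' != 0 -> 1 - y * y' != 0 ->
  pair_weight y^-1 y' * pair_weight y y' = 1.
Proof.
move=> y0 yy' yy1; rewrite /pair_weight; field.
by rewrite y0 yy' mulNr (mulrC y') yy1.
Qed.

Lemma subr_inv_neq0 (u y : F) : y != 0 -> u * y - 1 != 0 -> u - y^-1 != 0.
Proof.
by move=> y0 uy; rewrite -(mulfK y0 u) -[X in _ - X]mul1r -mulrBl mulf_neq0 ?invr_eq0.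
Qed.

(** Generically both sides are symmetric, so [f] may be written with [y] in second place. At
    [X = y^-1] the second term of [two_term_form] carries the factor [1 - X * y = 0], the first has
    Q = 1, and the weights of [X] and [y] against each other point multiply to 1. What is left is
    [Zpf (s1 ++ s2)]. *)
Lemma delta_at_inverse s1 y s2 : good (s1 ++ y :: s2) ->
  Zlat (s1 ++ s2) = Zpf (s1 ++ s2) ->
  exists f, [/\ regular_at y^-1 f, f y^-1 = 0 &
    @generic F (fun X => f X = den (s1 ++ y :: s2) X *
      (Zlat (X :: s1 ++ y :: s2) - Zpf (X :: s1 ++ y :: s2)))].
Proof.
set s := s1 ++ y :: s2; set s' := s1 ++ s2 => gs ZG.
have gs' : good (y :: s') by apply: good_perm gs; rewrite /s /s' -(cat1s y s2) perm_catCA.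
have my := mem_head y s'; have [y0 ay cy ay1 cy1] := good1 gs' my.
have my' u : u \in s' -> u \in y :: s' by move=> us; rewrite inE us orbT.
have yneq u : u \in s' -> y - u != 0.
  move=> us; rewrite subr_eq0; apply: contraTneq us => <-.
  by have /andP[] := good_uniq gs'.
have aV := subr_inv_neq0 y0 ay1; have cV := subr_inv_neq0 y0 cy1.
have [yy _ _] := good2 gs' my my.
have yV u : u \in y :: s' -> y^-1 - u != 0.
  move=> us; have [yu _ _] := good2 gs' my us.
  by rewrite -opprB oppr_eq0 subr_inv_neq0 // mulrC -opprB oppr_eq0.
have qV u : u \in y :: s' -> 1 - q * (y^-1 * u) != 0.
  move=> us; have [_ _ yu] := good2 gs' my us.
  have -> : 1 - q * (y^-1 * u) = y^-1 * (y - q * u) by field.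
  by rewrite mulf_neq0 ?invr_eq0.
exists (fun X => den s X * (Zlat (X :: y :: s') - two_term_form y s' X)).
split.
- apply: regular_mul; first exact: regular_den.
  apply: regular_sub; first exact: regular_Zlat.
  rewrite /two_term_form; apply: regular_mul.
    by regular; apply: regular_pair_weights => u us; exact: yV (my' _ us).
  apply: regular_sub.
    apply: regular_mul; last by regular.
    by apply: (@regular_Qfun _ _ (fun=> q) (fun=> a) (fun=> c) id (fun=> y));
      regular; exact: qV.
  apply: regular_mul; first by rewrite /pair_weight; regular; exact: yV.
  apply: regular_sum => j _.
  have kr : regular_at y^-1 (fun X => pairing (Some X) (nth None (points s') j)).
    apply: (regular_pairing (s := s')) => //.
      move=> u us; have [_ au cu _ _] := good1 gs' (my' _ us).
      split=> //; last exact: qV (my' _ us).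
      have -> : 1 - y^-1 * u = y^-1 * (y - u) by field.
      by rewrite mulf_neq0 ?invr_eq0 // yneq.
    have := mem_nth None (ltn_ord j); rewrite mem_cat mem_nseq.
    by move=> /orP[/andP[_ /eqP]|/mapP[u us ->]]; [left | right; exists u].
  by regular.
- rewrite Zlat_inv //; last by rewrite eq_sym -subr_eq0.
  rewrite -/s' ZG /two_term_form [pair_weight _ y]/pair_weight mulVf //.
  rewrite subrr !mul0r subr0 Qfun_inv //.
  rewrite -big_split big1_seq; last first.
    move=> u /= us; apply: pair_weight_inv => //; first exact: yneq.
    by have [] := good2 gs' my (my' _ us).
  by rewrite !mul1r subrr mulr0.
apply: generic_sub (generic_and (generic_good gs)
  (generic_and (generic_subr y) (generic_1sub y))) => X [gX [Xy Xy1]].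
rewrite -Zpf_cons2 //; last by rewrite mulrC.
by rewrite (Zpf_move [:: X]) (@Zlat_move [:: X]).
Qed.

Lemma Zlat_eq_Zpf_step x s : (a - 1 != 0) && (a + 1 != 0) -> (c - 1 != 0) && (c + 1 != 0) ->
  good (x :: s) -> Zlat s = Zpf s ->
  (forall s1 y s2, s = s1 ++ y :: s2 -> Zlat (s1 ++ s2) = Zpf (s1 ++ s2)) ->
  Zlat (x :: s) = Zpf (x :: s).
Proof.
move=> /andP[am ap] /andP[cm cp] gxs ZG ZGdel.
have gs := good_tail gxs.
pose delta X := den s X * (Zlat (X :: s) - Zpf (X :: s)).
have [p sp pE] : poly_generic (2 + size s + size s) delta by exact: poly_generic_delta.
(* [p] agrees with [delta] only generically; a regular representative [f] carries the zero over to
   [p] at the node itself. *)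
have root_p t0 f : regular_at t0 f -> f t0 = 0 ->
    @generic F (fun X => f X = delta X) -> root p t0.
  move=> fr f0 fd; rewrite /root -f0; apply/eqP/esym.
  apply: (regular_eq fr (regular_horner t0 p)).
  by apply: generic_sub (generic_and fd pE) => X [-> ->].
have p0 : p = 0.
  apply/eqP; apply: contraT => pn0.
  (* These are 3 + 2 n points, one more than the degree bound 2 + 2 n allows to a nonzero [p]. *)
  pose rs := [:: 0, 1, -1 & s ++ [seq y^-1 | y <- s]].
  have := max_poly_roots pn0 (rs := rs).
  have -> : (size rs < size p)%N = false.
    by apply/negbTE; rewrite -leqNgt (leq_trans sp) //= size_cat size_map -addnA add2n.
  apply.
    rewrite /= all_cat; apply/and5P; split.
    - apply: (root_p 0 delta) => //; [exact: regular_delta_at_0| |exact: generic_all].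
      by rewrite /delta Zlat0 // Zpf0 // subrr mulr0.
    - have [dr dE] := generic_delta_at_sqr1 (x := 1) gs (expr1n _ 2) am cm ZG.
      apply: (root_p _ delta) => //; last exact: generic_all.
      by rewrite /delta dE subrr mulr0.
    - have [dr dE] : regular_at (-1) delta /\ Zlat (-1 :: s) = Zpf (-1 :: s).
        by apply: generic_delta_at_sqr1; rewrite ?opprK ?sqrrN ?expr1n.
      apply: (root_p _ delta) => //; last exact: generic_all.
      by rewrite /delta dE subrr mulr0.
    - by apply/allP => y ys; have [f [fr f0 fd]] := delta_at_node gs ys; exact: root_p fd.
    apply/allP => _ /mapP[y ys ->].
    have [s1 [s2 sE]] : exists s1 s2, s = s1 ++ y :: s2.
      by case/splitPr: ys => s1 s2; exists s1, s2.
    have := @delta_at_inverse s1 y s2; rewrite -sE => /(_ gs (ZGdel _ _ _ sE)).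
    by move=> [f [fr f0 fd]]; exact: root_p fd.
  have n0 y : y \in s -> [/\ y != 0, y != 1 & y != -1].
    move=> ys; have [y0 _ _ _ _] := good1 gs ys; have [yy _ _] := good2 gs ys ys.
    split=> //; apply: contraNneq yy => ->; rewrite ?mulrNN ?mul1r ?subrr //.
  have m11 : 1 != -1 :> F by rewrite -addr_eq0 -mulr2n pnatr_eq0.
  rewrite /= !inE !mem_cat !negb_or cat_uniq (good_uniq gs).
  rewrite (map_inj_uniq (@invr_inj F)) (good_uniq gs).
  rewrite eq_sym oner_eq0 eq_sym oppr_eq0 oner_eq0 m11 /= andbT.
  have nV u : u != 0 -> u^-1 \notin s -> u \notin [seq y^-1 | y <- s].
    by move=> u0; apply: contra => /mapP[y ys ->]; rewrite invrK.
  have notin u : (u = 0 \/ u = 1 \/ u = -1) -> u \notin s /\ u \notin [seq y^-1 | y <- s].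
    move=> uE; split; first by apply/negP => /n0[]; case: uE => [|[|]] ->; rewrite eqxx.
    apply/negP => /mapP[y /n0[y0 y1 ym] uV]; case: uE uV => [|[|]] -> /eqP.
    - by rewrite eq_sym invr_eq0 (negPf y0).
    - by rewrite eq_sym invr_eq1 (negPf y1).
    - by rewrite -(inj_eq (@invr_inj F)) invrN1 invrK eq_sym (negPf ym).
  have [-> ->] := notin 0 (or_introl erefl).
  have [-> ->] := notin 1 (or_intror (or_introl erefl)).
  have [-> ->] := notin (-1) (or_intror (or_intror erefl)).
  rewrite /=; apply/hasPn => _ /mapP[y ys ->]; apply/negP => ys'.
  have [] := good2 gs ys ys'; rewrite divff ?subrr ?eqxx //.
  by have [] := n0 _ ys.
have mx := mem_head x s; have [_ ax cx _ _] := good1 gxs mx.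
have ms y : y \in s -> y \in x :: s by move=> ys; rewrite inE ys orbT.
(* Interpolation gives equality for generic [X]; regularity at [x] specialises it. *)
apply: (@regular_eq _ x (fun X => Zlat (X :: s)) (fun X => Zpf (X :: s))).
- by apply: regular_Zlat => // y ys; have [] := good2 gxs mx (ms _ ys).
- apply: regular_Zpf => // y ys; have [_ ay cy _ _] := good1 gxs (ms _ ys).
    by have [] := good2 gxs mx (ms _ ys).
  rewrite subr_eq0; apply: contraTneq ys => <-; by have /andP[] := good_uniq gxs.
apply: generic_sub (generic_and (generic_good gs) pE) => X [gX].
rewrite p0 horner0 => /eqP; rewrite mulf_eq0 (negPf (den_neq0 gX)) /= subr_eq0.
by move/eqP.
Qed.

Lemma Zlat_eq_Zpf s : (a - 1 != 0) && (a + 1 != 0) -> (c - 1 != 0) && (c + 1 != 0) ->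
  good s -> Zlat s = Zpf s.
Proof.
move=> a1 c1; have [n] := ubnP (size s); elim: n s => // n IH [|x s] /= sn gs.
  by rewrite Zpf_nil.
have gs' := good_tail gs.
apply: Zlat_eq_Zpf_step => //; first exact: IH.
move=> s1 y s2 sE; apply: IH.
  have szE : size s = (size (s1 ++ s2)).+1 by rewrite sE !size_cat addnS.
  by rewrite ltnS in sn; apply: leq_trans (ltnW sn); rewrite szE.
apply: (good_sub _ _ gs').
  by have := good_uniq gs'; rewrite sE -cat1s uniq_catCA /= => /andP[].
by move=> u; rewrite sE !mem_cat inE => /orP[]->; rewrite ?orbT.
Qed.

End Interpolation.

(** * Sums over edge configurations *)

Definition ffun_cons (T : Type) m (b : T) (g : {ffun 'I_m -> T}) : {ffun 'I_m.+1 -> T} :=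
  [ffun i => if unlift ord0 i is Some j then g j else b].

Lemma ffun_cons0 (T : Type) m (b : T) (g : {ffun 'I_m -> T}) : ffun_cons b g ord0 = b.
Proof. by rewrite ffunE unlift_none. Qed.

Lemma ffun_consS (T : Type) m (b : T) (g : {ffun 'I_m -> T}) i :
  ffun_cons b g (lift ord0 i) = g i.
Proof. by rewrite ffunE liftK. Qed.

Lemma sum_ffun_cons (V : nmodType) (T : finType) m (f : {ffun 'I_m.+1 -> T} -> V) :
  \sum_g f g = \sum_b \sum_g f (ffun_cons b g).
Proof.
rewrite pair_big /= (reindex (fun p : T * {ffun 'I_m -> T} => ffun_cons p.1 p.2)) //.
exists (fun g : {ffun 'I_m.+1 -> T} => (g ord0, [ffun i => g (lift ord0 i)])) => [[b g] _|g _] /=.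
  by congr (_, _); [rewrite ffun_cons0 | apply/ffunP => i; rewrite ffunE ffun_consS].
apply/ffunP => i; case: (unliftP ord0 i) => [j|] ->; first by rewrite ffun_consS ffunE.
by rewrite ffun_cons0.
Qed.

Lemma forall_ordS m (p : pred 'I_m.+1) :
  [forall i, p i] = p ord0 && [forall i, p (lift ord0 i)].
Proof.
apply/forallP/andP => [pP | [p0 /forallP pS] i]; first by split=> //; apply/forallP.
by case: (unliftP ord0 i) => [j|] ->.
Qed.

Lemma widen_ord_lift m (i : 'I_m) :
  widen_ord (leqnSn m.+1) (lift ord0 i) = lift ord0 (widen_ord (leqnSn m) i).
Proof. exact: val_inj. Qed.

Lemma lift_ord_max m : lift ord0 (@ord_max m) = @ord_max m.+1.
Proof. exact: val_inj. Qed.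

Definition ord_seq (T : Type) m (x : 'I_m -> T) : seq T := [seq x i | i <- enum 'I_m].

Lemma ord_seqS (T : Type) m (x : 'I_m.+1 -> T) :
  ord_seq x = x ord0 :: ord_seq (fun i => x (lift ord0 i)).
Proof. by rewrite /ord_seq enum_ordSl /= -map_comp. Qed.

Section Link.
Variables (F : fieldType) (q a c : F).

(** The entry of the row transfer matrix from bottom states [v] to top states [v']. [g] lists the
    edges to the right of the crossings, so [ffun_cons l g] lists all horizontal edges of the row
    behind the turn. *)
Definition config_row_weight m x0 (x : 'I_m -> F) l (v v' : 'I_m -> bool) : F :=
  \sum_(g : {ffun 'I_m -> bool} | ~~ ffun_cons l g ord_max)
    \prod_(i < m) bulk_weight q (x0 * x i) (v i)
      (ffun_cons l g (widen_ord (leqnSn m) i)) (v' i) (g i).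

Lemma row_sum_weightS m x0 (x : 'I_m.+1 -> F) l (v v' : 'I_m.+1 -> bool) :
  config_row_weight x0 x l v v' =
  \sum_r bulk_weight q (x0 * x ord0) (v ord0) l (v' ord0) r *
    config_row_weight x0 (fun i => x (lift ord0 i)) r (fun i => v (lift ord0 i))
      (fun i => v' (lift ord0 i)).
Proof.
rewrite /config_row_weight big_mkcond sum_ffun_cons; apply: eq_bigr => r _.
rewrite [in RHS]big_mkcond big_distrr; apply: eq_bigr => g _ /=.
rewrite -lift_ord_max ffun_consS; case: ifP => _; last by rewrite mulr0.
rewrite big_ord_recl ffun_cons0 (_ : widen_ord _ _ = ord0) ?ffun_cons0; last exact: val_inj.
by congr (_ * _); apply: eq_bigr => i _; rewrite widen_ord_lift !ffun_consS.
Qed.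

Lemma eq_row_sum_weight m x0 (x : 'I_m -> F) l v v1 v' v1' : v =1 v1 -> v' =1 v1' ->
  config_row_weight x0 x l v v' = config_row_weight x0 x l v1 v1'.
Proof.
by move=> vE v'E; apply: eq_bigr => g _; apply: eq_bigr => i _; rewrite vE v'E.
Qed.

Lemma row_weight_ffun m x0 (x : 'I_m -> F) l (v : 'I_m -> bool) k :
  row_weight q x0 l (ord_seq x) (ord_seq v) k =
  \sum_(v' : {ffun 'I_m -> bool}) config_row_weight x0 x l v v' * k (ord_seq v').
Proof.
elim: m x l v k => [|m IH] x l v k.
  have fE (g : {ffun 'I_0 -> bool}) : g = [ffun=> false] by apply/ffunP => -[].
  rewrite /ord_seq (size0nil (size_enum_ord 0)) /=.
  rewrite (big_pred1 [ffun=> false]) => [|g]; last by rewrite /= [g]fE eqxx.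
  rewrite /config_row_weight big_mkcond /= (big_pred1 [ffun=> false]) => [|g]; last first.
    by rewrite /= [g]fE eqxx.
  rewrite (_ : ord_max = ord0); last exact: val_inj.
  by rewrite ffun_cons0 big_ord0; case: l; rewrite /= ?mul0r ?mul1r.
rewrite !ord_seqS /= sum_ffun_cons exchange_big /=; apply: eq_bigr => t _.
under eq_bigr => r _ do rewrite IH big_distrr.
rewrite exchange_big /=; apply: eq_bigr => v' _.
rewrite row_sum_weightS ord_seqS !ffun_cons0 mulr_suml; apply: eq_bigr => r _.
rewrite mulrA; congr (_ * _ * k (_ :: _)).
  by apply: eq_row_sum_weight => // i; rewrite ffun_consS.
by apply: eq_map => i; rewrite ffun_consS.
Qed.

(** Arbitrary entrances make induction on the number of lines possible: once the lowest row is
    removed, its top states are the new entrances. *)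
Definition partition_from m (x : 'I_m -> F) (v : 'I_m -> bool) : F :=
  \sum_(e : edge_config m | [forall i, (e (i, ord0) == v i) && ~~ e (i, ord_max)])
    config_weight q a c x e.

(** The new line becomes the lowest row, which every old line crosses before its former first edge.
    [f] gives all edges of the new line and [v] the new entrances of the old lines, whose former
    edges shift up by one. *)
Definition add_line m (f : {ffun 'I_m.+2 -> bool}) (v : {ffun 'I_m -> bool})
    (e : edge_config m) : edge_config m.+1 :=
  [ffun p : 'I_m.+1 * 'I_m.+2 => if unlift ord0 p.1 is Some i then
     if unlift ord0 p.2 is Some k then e (i, k) else v i
   else f p.2].

Lemma add_line0 m f v (e : edge_config m) k : add_line f v e (ord0, k) = f k.
Proof. by rewrite ffunE unlift_none. Qed.

Lemma add_lineS0 m f v (e : edge_config m) i : add_line f v e (lift ord0 i, ord0) = v i.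
Proof. by rewrite ffunE liftK unlift_none. Qed.

Lemma add_lineSS m f v (e : edge_config m) i k :
  add_line f v e (lift ord0 i, lift ord0 k) = e (i, k).
Proof. by rewrite ffunE !liftK. Qed.

Lemma sum_add_line m (V : nmodType) (w : edge_config m.+1 -> V) :
  \sum_e w e = \sum_f \sum_v \sum_e w (add_line f v e).
Proof.
rewrite [RHS](eq_bigr _ (fun f _ => pair_big _ _ _)) pair_big /=.
rewrite (reindex (fun t : {ffun 'I_m.+2 -> bool} * ({ffun 'I_m -> bool} * edge_config m) =>
  add_line t.1 t.2.1 t.2.2)) //.
exists (fun e : edge_config m.+1 => ([ffun k => e (ord0, k)], ([ffun i => e (lift ord0 i, ord0)],
  [ffun p => e (lift ord0 p.1, lift ord0 p.2)]))) => [[f [v e]] _|e _] /=.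
  congr (_, (_, _)); apply/ffunP; first by move=> k; rewrite ffunE add_line0.
    by move=> i; rewrite ffunE add_lineS0.
  by move=> [i k]; rewrite ffunE add_lineSS.
apply/ffunP => -[i k]; case: (unliftP ord0 i) => [i'|] ->.
  case: (unliftP ord0 k) => [k'|] ->; first by rewrite add_lineSS ffunE.
  by rewrite add_lineS0 ffunE.
by rewrite add_line0 ffunE.
Qed.

Lemma config_weight_add_line m (x : 'I_m.+1 -> F) f v (e : edge_config m) :
  config_weight q a c x (add_line f v e) =
  boundary_weight a c (x ord0) (f ord0) (f (lift ord0 ord0)) *
  (\prod_(i < m) bulk_weight q (x ord0 * x (lift ord0 i)) (v i)
     (f (lift ord0 (widen_ord (leqnSn m) i))) (e (i, ord0)) (f (lift ord0 (lift ord0 i)))) *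
  config_weight q a c (fun i => x (lift ord0 i)) e.
Proof.
have w0 n : widen_ord (leqnSn n.+1) ord0 = ord0 by exact: val_inj.
rewrite /config_weight /edge_in /edge_out !big_ord_recl !w0 !add_line0.
rewrite [X in _ * (X * _)]big_pred0 // mul1r -!mulrA; congr (_ * _).
rewrite [RHS]mulrCA; congr (_ * _).
  by apply: eq_bigr => i _; rewrite widen_ord_lift !add_lineSS.
rewrite -big_split; apply: eq_bigr => i _ /=.
rewrite big_mkcond big_ord_recl /= w0 add_lineS0 add_lineSS !add_line0 widen_ord_lift.
rewrite (mulrC (x _)); congr (_ * _); rewrite [RHS]big_mkcond.
apply: eq_bigr => j _; rewrite /bump /= ltnS; case: ifP => // _.
by rewrite !widen_ord_lift !add_lineSS.
Qed.

Lemma partition_from_lattice m (x : 'I_m -> F) (v : 'I_m -> bool) :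
  partition_from x v = lattice q a c (ord_seq x) (ord_seq v).
Proof.
elim: m x v => [|m IH] x v.
  rewrite /ord_seq (size0nil (size_enum_ord 0)) /=.
  have eE (e : edge_config 0) : e = [ffun=> false] by apply/ffunP => -[[]].
  rewrite /partition_from (big_pred1 [ffun=> false]) => [|e].
    by rewrite /config_weight !big_ord0 mulr1.
  by rewrite /= [e]eE eqxx; apply/forallP => -[].
rewrite !ord_seqS /=; under [RHS]eq_bigr => l _ do rewrite row_weight_ffun.
rewrite /partition_from big_mkcond sum_add_line sum_ffun_cons.
rewrite (bigD1 (v ord0)) //= [X in _ + X]big1 ?addr0; last first.
  move=> b bv; apply: big1 => f _; apply: big1 => v' _; apply: big1 => e _.
  by rewrite forall_ordS add_line0 ffun_cons0 (negPf bv).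
rewrite sum_ffun_cons; apply: eq_bigr => l _.
rewrite exchange_big (bigD1 [ffun i => v (lift ord0 i)]) //= [X in _ + X]big1 ?addr0; last first.
  move=> vb vbv; apply: big1 => g _; apply: big1 => e _; case: ifP => //.
  rewrite forall_ordS => /andP[_ /forallP eP]; case/eqP: vbv; apply/ffunP => i.
  by have := eP i; rewrite add_lineS0 => /andP[/eqP-> _]; rewrite ffunE.
rewrite [RHS]big_distrr /=; under [RHS]eq_bigr => v' _ do rewrite -IH.
rewrite exchange_big /=.
(* The entrances of the remaining configuration are the top states of the removed row, the summation
   variable on the other side. *)
rewrite (partition_big (fun e : edge_config m => [ffun i => e (i, ord0)]) predT) //=.
apply: eq_bigr => v' _.
rewrite mulrA big_distrr /= big_mkcond [RHS]big_mkcond /=; apply: eq_bigr => e _.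
have condE g : [forall i, (add_line (ffun_cons (v ord0) (ffun_cons l g))
      [ffun i => v (lift ord0 i)] e (i, ord0) == v i) &&
    ~~ add_line (ffun_cons (v ord0) (ffun_cons l g))
      [ffun i => v (lift ord0 i)] e (i, ord_max)] =
    ~~ ffun_cons l g ord_max && [forall i, ~~ e (i, ord_max)].
  rewrite forall_ordS !add_line0 ffun_cons0 eqxx -!lift_ord_max ffun_consS /=.
  congr (_ && _); apply: eq_forallb => i.
  by rewrite add_lineS0 ffunE eqxx add_lineSS.
case: eqP => [eE|neE]; last first.
  case: ifP => // /forallP eP; case: neE; apply/ffunP => i; rewrite ffunE.
  by have /andP[/eqP] := eP i.
have -> : [forall i, (e (i, ord0) == v' i) && ~~ e (i, ord_max)] =
    [forall i, ~~ e (i, ord_max)].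
  by apply: eq_forallb => i; rewrite -eE ffunE eqxx.
under eq_bigr => g _ do rewrite condE.
case: ifP => _; last by apply: big1 => g _; rewrite andbF.
rewrite /config_row_weight big_distrr big_distrl /= [RHS]big_mkcond; apply: eq_bigr => g _.
rewrite andbT; case: ifP => // _; rewrite config_weight_add_line ffun_cons0 ffun_consS ffun_cons0.
congr (_ * _ * _); apply: eq_bigr => i _.
by congr (bulk_weight _ _ _ _ _ _); rewrite ?ffun_consS // -?eE ffunE.
Qed.

Lemma partition_function_Zlat m (x : 'I_m -> F) :
  partition_function q a c x = Zlat q a c (ord_seq x).
Proof.
transitivity (partition_from x (fun=> false)).
  by apply: eq_bigl => e; apply: eq_forallb => i; case: (e _).
rewrite partition_from_lattice /Zlat; congr lattice.
by rewrite /ord_seq size_map; elim: (enum _) => //= i s ->.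
Qed.

End Link.

Section LinkPfaffian.
Variables (F : numFieldType) (q a c : F).

Lemma prod_ord_lt_lift m (f : 'I_m.+1 -> 'I_m.+1 -> F) :
  \prod_(i < m.+1) \prod_(j < m.+1 | (i < j)%N) f i j =
  (\prod_(j < m) f ord0 (lift ord0 j)) *
  \prod_(i < m) \prod_(j < m | (i < j)%N) f (lift ord0 i) (lift ord0 j).
Proof.
rewrite big_ord_recl; congr (_ * _).
  by rewrite big_mkcond big_ord_recl /= mul1r; apply: eq_bigr.
apply: eq_bigr => i _; rewrite big_mkcond big_ord_recl /= mul1r [RHS]big_mkcond.
by apply: eq_bigr => j _.
Qed.

Lemma weight_prod_ord_seq m (x : 'I_m -> F) :
  weight_prod (ord_seq x) =
  \prod_(i < m) \prod_(j < m | (i < j)%N) ((1 - x i * x j) / (x i - x j)).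
Proof.
elim: m x => [|m IH] x; first by rewrite /ord_seq (size0nil (size_enum_ord 0)) big_ord0.
rewrite ord_seqS /= prod_ord_lt_lift IH; congr (_ * _).
by rewrite /ord_seq big_map big_enum.
Qed.

Lemma Zpf_ord_seq m (x : 'I_m -> F) : ~~ odd m ->
  Zpf q a c (ord_seq x) =
  (\prod_(i < m) \prod_(j < m | (i < j)%N) ((1 - x i * x j) / (x i - x j))) *
  pfaffian (\matrix_(i < m, j < m)
    ((x i - x j) / (1 - x i * x j) * Qfun q a c (x i) (x j))).
Proof.
move=> em; have sz : size (ord_seq x) = m by rewrite size_map size_enum_ord.
rewrite /Zpf weight_prod_ord_seq /points sz (negPf em) /=; congr (_ * _).
rewrite /Pf size_map sz /pf_seq; congr pfaffian; apply/matrixP => i j; rewrite !mxE.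
have nthE (k : 'I_m) : nth None (map Some (ord_seq x)) k = Some (x k).
  by rewrite (nth_map (x k)) ?sz // (nth_map k) ?size_enum_ord // nth_ord_enum.
by rewrite !nthE.
Qed.

End LinkPfaffian.

(** * Deformation to general position *)

Section Perturbation.
Variable F : numFieldType.

Lemma regular_pfaffian t0 m (A : F -> 'M[F]_m) :
  (forall i j, regular_at t0 (fun t => A t i j)) ->
  regular_at t0 (fun t => pfaffian (A t)).
Proof.
move=> Ar; rewrite /pfaffian; apply: regular_mul; first exact: regular_const.
apply: regular_sum => s _; apply: regular_mul; first exact: regular_const.
by apply: regular_prod => i _; exact: Ar.
Qed.

Lemma regular_partition_function t0 m (q a c : F -> F) (x : 'I_m -> F -> F) :
  regular_at t0 q -> regular_at t0 a -> regular_at t0 c ->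
  (forall i, regular_at t0 (x i)) -> a t0 != 0 -> c t0 != 0 ->
  (forall i, a t0 - x i t0 != 0) -> (forall i, c t0 - x i t0 != 0) ->
  (forall i j : 'I_m, (j < i)%N -> 1 - q t0 * (x i t0 * x j t0) != 0) ->
  regular_at t0 (fun t => partition_function (q t) (a t) (c t) (fun i => x i t)).
Proof.
move=> qr ar cr xr a0 c0 ax cx qxx; rewrite /partition_function.
apply: regular_sum => e _; rewrite /config_weight; apply: regular_mul.
  by apply: regular_prod => i _; exact: regular_boundary.
apply: regular_prod => i _; apply: regular_prod => j ij.
by apply: regular_bulk => //; [apply: regular_mul | exact: qxx].
Qed.

(** Polynomials of different degrees differ, so general position along the curves reduces to
    counting degrees, whatever the starting values are. *)
Lemma generic_size (p r : {poly F}) (f : F -> F) : size p != size r ->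
  (forall t, f t = p.[t] - r.[t]) -> generic (fun t => f t != 0).
Proof.
move=> pr fE; have : p - r != 0.
  by rewrite subr_eq0; apply: contraNneq pr => ->.
by move/generic_poly; apply: generic_sub => t; rewrite fE hornerD hornerN.
Qed.

Definition shift n (u : F) : {poly F} := 'X^(n.+1) + u%:P.

Lemma size_shift n u : size (shift n u) = n.+2.
Proof. by rewrite size_XnaddC. Qed.

Lemma monic_shift n u : shift n u \is monic.
Proof.
by rewrite monicE lead_coefDl ?lead_coefXn // size_polyXn (leq_ltn_trans (size_polyC_leq1 _)).
Qed.

Lemma horner_shift n u t : (shift n u).[t] = t ^+ n.+1 + u.
Proof. by rewrite hornerD hornerXn hornerC. Qed.

Lemma size_monicM (p r : {poly F}) : p \is monic -> r \is monic ->
  size (p * r) = (size p + size r).-1.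
Proof. by move=> pm rm; rewrite size_mul ?monic_neq0. Qed.

(* The curves [t + q], [t + a], [t + c] and [t ^ (2 i + 2) + x i] have pairwise
   distinct degrees wherever [good] compares them; evenness of the last degree
   separates [x i] from [q * x j]. *)
Lemma generic_good_perturbed m (q a c : F) (x : 'I_m -> F) :
  let xt (t : F) (i : 'I_m) := t ^+ (i.*2).+2 + x i in
  generic (fun t => [/\ good (t + q) (t + a) (t + c) (ord_seq (xt t)),
    t + a != 0, t + c != 0, 1 - (t + q) != 0 &
    [/\ t + a - 1 != 0, t + a + 1 != 0, t + c - 1 != 0 & t + c + 1 != 0]]).
Proof.
move=> xt.
have sh u t : t + u = (shift 0 u).[t] by rewrite horner_shift expr1.
have xsh i t : xt t i = (shift (i.*2).+1 (x i)).[t] by rewrite horner_shift.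
have g0 u : @generic F (fun t => t + u != 0).
  by apply: (generic_size (p := shift 0 u) (r := 0)) => [|t];
    rewrite ?size_shift ?size_poly0 // horner0 subr0 sh.
have gm u : @generic F (fun t => t + u - 1 != 0).
  by apply: generic_sub (g0 (u - 1)) => t; rewrite addrA.
have gp u : @generic F (fun t => t + u + 1 != 0).
  by apply: generic_sub (g0 (u + 1)) => t; rewrite addrA.
have gq : @generic F (fun t => 1 - (t + q) != 0).
  by apply: generic_sub (gm q) => t; rewrite -opprB oppr_eq0.
have g1 i : @generic F (fun t => [/\ xt t i != 0, t + a - xt t i != 0, t + c - xt t i != 0,
     (t + a) * xt t i - 1 != 0 & (t + c) * xt t i - 1 != 0] /\
     (1 - (t + q) * xt t i != 0 /\ 1 + (t + q) * xt t i != 0)).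
  pose xi := shift (i.*2).+1 (x i).
  have sM u : size (shift 0 u * xi) = (i.*2).+4.
    by rewrite size_monicM ?monic_shift // !size_shift.
  have e1 : @generic F (fun t => xt t i != 0).
    apply: (generic_size (p := xi) (r := 0)) => [|t]; first by rewrite size_shift size_poly0.
    by rewrite horner0 subr0 xsh.
  have e2 u : @generic F (fun t => t + u - xt t i != 0).
    apply: (generic_size (p := shift 0 u) (r := xi)) => [|t]; first by rewrite /xi !size_shift.
    by rewrite (sh u) xsh.
  have e3 u : @generic F (fun t => (t + u) * xt t i - 1 != 0).
    apply: (generic_size (p := shift 0 u * xi) (r := 1)) => [|t]; first by rewrite sM size_poly1.
    by rewrite hornerM hornerC (sh _ t) xsh.
  have e4 : @generic F (fun t => 1 + (t + q) * xt t i != 0).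
    apply: (generic_size (p := shift 0 q * xi) (r := - 1)) => [|t].
      by rewrite sM size_polyN size_poly1.
    by rewrite hornerN hornerM hornerC (sh _ t) xsh opprK addrC.
  have := generic_and e1 (generic_and (e2 a) (generic_and (e2 c) (generic_and (e3 a)
    (generic_and (e3 c) (generic_and (e3 q) e4))))).
  apply: generic_sub => t [? [? [? [? [? [? ?]]]]]]; split=> //; split=> //.
  by rewrite -opprB oppr_eq0.
have g2 i j : @generic F (fun t => [/\ 1 - xt t i * xt t j != 0,
    1 - (t + q) * (xt t i * xt t j) != 0, xt t i - (t + q) * xt t j != 0 &
    i != j -> xt t i != xt t j]).
  pose xi (k : 'I_m) := shift (k.*2).+1 (x k).
  have e1 : @generic F (fun t => 1 - xt t i * xt t j != 0).
    apply: (generic_size (p := 1) (r := xi i * xi j)) => [|t].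
      by rewrite size_monicM ?monic_shift // !size_shift size_poly1.
    by rewrite hornerM hornerC !xsh.
  have e2 : @generic F (fun t => 1 - (t + q) * (xt t i * xt t j) != 0).
    apply: (generic_size (p := 1) (r := shift 0 q * (xi i * xi j))) => [|t].
      by rewrite !size_monicM ?monicMl ?monic_shift // !size_shift size_poly1.
    by rewrite !hornerM hornerC sh !xsh.
  have e3 : @generic F (fun t => xt t i - (t + q) * xt t j != 0).
    apply: (generic_size (p := xi i) (r := shift 0 q * xi j)) => [|t].
      rewrite size_monicM ?monic_shift // !size_shift /=.
      by apply/eqP => /(congr1 odd); rewrite /= !odd_double.
    by rewrite hornerM sh !xsh.
  have e4 : @generic F (fun t => i != j -> xt t i != xt t j).
    have [-> | ij] := eqVneq i j; first exact: generic_all.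
    have: @generic F (fun t => xt t i - xt t j != 0).
      apply: (generic_size (p := xi i) (r := xi j)) => [|t]; last by rewrite !xsh.
      by rewrite !size_shift !eqSS (inj_eq double_inj).
    by apply: generic_sub => t; rewrite subr_eq0.
  have := generic_and e1 (generic_and e2 (generic_and e3 e4)).
  by apply: generic_sub => t [? [? [? ?]]]; split.
have G1 := @generic_in F _ (enum 'I_m) _ (fun i _ => g1 i).
have G2 := @generic_in F _ (enum 'I_m) _ (fun i _ =>
  @generic_in F _ (enum 'I_m) _ (fun j _ => g2 i j)).
have := generic_and G1 (generic_and G2 (generic_and (g0 a) (generic_and (g0 c) (generic_and gq
  (generic_and (generic_and (gm a) (gp a)) (generic_and (gm c) (gp c))))))).
apply: generic_sub => t [h1 [h2 [? [? [? [[? ?] [? ?]]]]]]]; split=> //; split.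
- rewrite map_inj_in_uniq ?enum_uniq // => i j im jm xij; apply/eqP; apply: contraT => ij.
  by have [_ _ _ /(_ ij)] := h2 i im j jm; rewrite xij eqxx.
- by move=> _ /mapP[i im ->]; have [] := h1 i im.
- by move=> _ /mapP[i im ->]; have [] := h1 i im.
- by move=> _ _ /mapP[i im ->] /mapP[j jm ->]; have [] := h2 i im j jm.
Qed.

(** Values such as [q = 1], [a = 1] or [x i = 0], where the interpolation breaks down, are reached
    as the points [t = 0] of the curves. *)
Lemma partition_function_pfaffian m (q a c : F) (x : 'I_m -> F) :
  ~~ odd m -> a != 0 -> c != 0 ->
  (forall i, a - x i != 0) -> (forall i, c - x i != 0) ->
  (forall i j : 'I_m, (i < j)%N -> x i - x j != 0) ->
  (forall i j : 'I_m, (i < j)%N -> 1 - x i * x j != 0) ->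
  (forall i j : 'I_m, (i < j)%N -> 1 - q * x i * x j != 0) ->
  partition_function q a c x =
  (\prod_(i < m) \prod_(j < m | (i < j)%N) ((1 - x i * x j) / (x i - x j))) *
  pfaffian (\matrix_(i < m, j < m)
    ((x i - x j) / (1 - x i * x j) * Qfun q a c (x i) (x j))).
Proof.
move=> em a0 c0 ax cx xx xx1 qxx1.
pose xt (i : 'I_m) (t : F) := t ^+ (i.*2).+2 + x i.
pose lhs t := partition_function (t + q) (t + a) (t + c) (fun i => xt i t).
pose rhs t := (\prod_(i < m) \prod_(j < m | (i < j)%N)
    ((1 - xt i t * xt j t) / (xt i t - xt j t))) *
  pfaffian (\matrix_(i < m, j < m) ((xt i t - xt j t) / (1 - xt i t * xt j t) *
    Qfun (t + q) (t + a) (t + c) (xt i t) (xt j t))).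
have xt0 i : xt i 0 = x i by rewrite /xt expr0n add0r.
suff : lhs 0 = rhs 0.
  have -> : lhs 0 = partition_function q a c x.
    rewrite /lhs !add0r; apply: eq_bigr => e _; congr (_ * _).
      by apply: eq_bigr => i _; rewrite xt0.
    by apply: eq_bigr => i _; apply: eq_bigr => j _; rewrite !xt0.
  rewrite /rhs !add0r => ->; congr (_ * _).
    by apply: eq_bigr => i _; apply: eq_bigr => j _; rewrite !xt0.
  by congr pfaffian; apply/matrixP => i j; rewrite !mxE !xt0.
have ur u : regular_at 0 (fun t : F => t + u) by regular.
have xr i : regular_at 0 (xt i) by rewrite /xt; regular.
apply: (@regular_eq _ 0 lhs rhs).
- apply: regular_partition_function => //; rewrite ?add0r //.
  + by move=> i; rewrite xt0.
  + by move=> i; rewrite xt0.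
  by move=> i j ij; rewrite !xt0 (mulrC (x i)) mulrA qxx1.
- apply: regular_mul.
    apply: regular_prod => i _; apply: regular_prod => j ij.
    by regular; rewrite ?xt0 ?xx //; exact: xr.
  apply: regular_pfaffian => i j; apply: eq_regular; first by move=> t; rewrite mxE.
  (* On the diagonal [1 - x i * x i] or [1 - q * x i * x i] may be 0, but the numerator vanishes for
     every [t], so the entry is constantly 0. *)
  have [-> | ij] := eqVneq i j.
    by apply: eq_regular (regular_const 0 0) => t; rewrite subrr !mul0r.
  have [x1 qx1] : 1 - x i * x j != 0 /\ 1 - q * (x i * x j) != 0.
    move: ij; rewrite -val_eqE neq_ltn => /orP[] ij.
      by rewrite xx1 // mulrA qxx1.
    by rewrite (mulrC (x i)) xx1 // mulrA qxx1.
  apply: regular_mul; first by apply: regular_div; rewrite ?xt0 //; regular; exact: xr.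
  by apply: regular_Qfun; rewrite ?add0r ?xt0 // -mulrA.
apply: generic_sub (generic_good_perturbed q a c x) => t.
move=> [gt ta tc tq [am ap cm cp]].
rewrite /lhs /rhs -Zpf_ord_seq // partition_function_Zlat; apply: Zlat_eq_Zpf => //; exact/andP.
Qed.

End Perturbation.

Theorem theorem4p8 (R : realType) (q a c : R[i]) (m : nat) (x : 'I_m -> R[i])
  (m_even : ~~ odd m)
  (a_neq0 : a != 0) (c_neq0 : c != 0)
  (ax_neq0 : forall i : 'I_m, a - x i != 0)
  (cx_neq0 : forall i : 'I_m, c - x i != 0)
  (x_inj : forall i j : 'I_m, (i < j)%N -> x i - x j != 0)
  (xx_neq1 : forall i j : 'I_m, (i < j)%N -> 1 - x i * x j != 0)
  (qxx_neq1 : forall i j : 'I_m, (i < j)%N -> 1 - q * x i * x j != 0) :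
  partition_function q a c x =
  (\prod_(i < m) \prod_(j < m | (i < j)%N) ((1 - x i * x j) / (x i - x j))) *
  pfaffian (\matrix_(i < m, j < m)
    ((x i - x j) / (1 - x i * x j) * Qfun q a c (x i) (x j))).
Proof. exact: partition_function_pfaffian. Qed.
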